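(* Let $\mathcal{X}=\mathbb{R}^n$. Let $f:\mathbb{R}^n\to\mathbb{R}$ be continuously differentiable with $L$-Lipschitz gradient and $\mu$-strongly convex ($\nabla^2f(x)\succeq\mu I$ for all $x\in\mathbb{R}^n$). For any $x_{-1}$, $\lambda_0$ and $\alpha>0$, let $\{(x_k,\lambda_k)\}$ be the sequence of primal-dual iterates generated by the inexact augmented Lagrangian method. Suppose that at each iteration $k\in\mathbb{N}$ the primal iterate satisfies $$\mathbb{E}_k[\|R(x_k,\lambda_k;\alpha,\eta)\|^2]\le\tilde\theta_e^2\|c(x_k^* )\|^2+\tilde\tau_k,$$ where $x_k^*$ is the minimizer of $\mathcal{L}(\cdot,\lambda_k;\alpha)$, $\tilde\theta_e\in[0,1)$, $\tilde\theta_e\le\frac{\mu\theta_e}{2\|A\|}$, $\tilde\tau_k=\frac{\mu^2\tau_k}{4\|A\|^2}$, $\theta_e\in[0,1)$, and $\tau_k=\tau_0(1/a)^k$ for some $\tau_0>0$ and $a>1$. Then $$\mathbb{E}[\|c(x_k)\|^2]\le A_1\rho^k\quad\text{and}\quad\mathbb{E}[\|\nabla_x\ell(x_k,\lambda_{k+1})\|^2]\le A_2\rho^k,$$ where $A_1=4(1+\theta_e^2)L_\alpha A_3+2\tau_0$, $A_2=2L_\alpha\tilde\theta_e^2A_3+\frac{\mu^2\tau_0}{4\|A\|^2}$, $A_3=\max\left\{q_\alpha(\lambda_0)-q_\alpha(\lambda^* ),\frac{\tau_0}{\mu_\alpha(1-\theta_e^2)}\right\}$, $\rho=\max\left\{1-\frac{\alpha\mu_\alpha(1-\theta_e^2)}{2},\frac1a\right\}<1$,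 and $\mu_\alpha=\frac{\mu_q}{\mu_q\alpha+1}$. Here $L_\alpha=\alpha^{-1}$, $\lambda^*=\arg\min_\lambda q_\alpha(\lambda)$, and $\mu_q=\frac{\sigma}{\mu+L}$ with $\sigma=\lambda_{\min}(AA^T)$ is the strong convexity parameter of the negative dual function $q$.
   Context: Problem: minimize $f(x)=\mathbb{E}_\zeta[F(x,\zeta)]$ over $x\in\mathbb{R}^n$ subject to $c(x)=0$, with $F(\cdot,\zeta)$ smooth random functions and $c(x)=Ax-b$, $A\in\mathbb{R}^{m\times n}$, $b\in\mathbb{R}^m$. $\|\cdot\|$ is the $\ell_2$ vector/matrix norm; $\lambda_{\min}$ denotes the smallest eigenvalue; $\mathbb{N}=\{0,1,\dots\}$. $\ell(x,\lambda)=f(x)-\langle\lambda,c(x)\rangle$, $\nabla_x\ell(x,\lambda)=\nabla f(x)-A^T\lambda$; $\mathcal{L}(x,\lambda;\alpha)=f(x)-\langle\lambda,c(x)\rangle+\frac\alpha2\|c(x)\|^2$; negative dual function $q(\lambda)=-\min_{x\in\mathbb{R}^n}\ell(x,\lambda)$; Moreau envelope $q_\alpha(u)=\min_\lambda[q(\lambda)+\frac1{2\alpha}\|\lambda-u\|^2]$. In general $R(x,\lambda;\alpha,\eta)=\frac1\eta(\mathrm{proj}_{\mathcal{X}}(x-\eta\nabla_x\mathcal{L}(x,\lambda;\alpha))-x)$ with step size $\eta>0$ and $\mathrm{proj}_{\mathcal{X}}$ the Euclidean projection; for $\mathcal{X}=\mathbb{R}^n$ this is $-\nabla_x\mathcal{L}(x,\lambda;\alpha)$.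 Inexact augmented Lagrangian method: given $x_{-1}\in\mathbb{R}^n$, $\lambda_0\in\mathbb{R}^m$, $\alpha>0$; for $k=0,1,\dots$, a stochastic subproblem solver started at $x_{k-1}$ produces a random approximate minimizer $x_k$ of $\min_x\mathcal{L}(x,\lambda_k;\alpha)$ satisfying the prescribed inexactness condition, and then $\lambda_{k+1}=\lambda_k-\alpha c(x_k)$. $\mathbb{E}_k$ denotes conditional expectation given all randomness of outer iterations $0,\dots,k-1$ (so $x_{k-1},\lambda_k$ are known); $\mathbb{E}$ is full expectation. *)

(* Defs.v *)
From HB Require Import structures.
From mathcomp Require Import all_boot all_order all_algebra.
From mathcomp Require Import all_classical all_reals all_analysis measurable_realfun.
From mathcomp Require Import ring lra.

Set Implicit Arguments.
Unset Strict Implicit.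
Unset Printing Implicit Defensive.

Import Order.TTheory GRing.Theory Num.Theory.
Import numFieldNormedType.Exports.

Local Open Scope classical_set_scope.
Local Open Scope ring_scope.

(* The norm `|_| that the library puts on matrices is the max norm, so the
   Euclidean norm has to be introduced separately.  Topological notions
   (continuity, differentiability) are the same for both. *)
Definition dotv (R : realType) (n : nat) (u v : 'cV[R]_n) : R :=
  \sum_(i < n) u i 0 * v i 0.

Definition enorm (R : realType) (n : nat) (u : 'cV[R]_n) : R :=
  Num.sqrt (dotv u u).

Definition mxnorm2 (R : realType) (m n : nat) (A : 'M[R]_(m, n)) : R :=
  sup [set enorm (A *m v) | v in [set v : 'cV[R]_n | enorm v <= 1]].

(* Used for symmetric matrices only: their real eigenvalues form a finite
   nonempty set (when n > 0), so the infimum is the smallest of them. *)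
Definition lambda_min (R : realType) (n : nat) (M : 'M[R]_n) : R :=
  inf [set a : R | eigenvalue M a].

Definition grad (R : realType) (n : nat) (f : 'cV[R]_n -> R) (x : 'cV[R]_n) :
  'cV[R]_n := \col_i 'D_(delta_mx i 0) f x.

Definition C1 (R : realType) (n : nat) (f : 'cV[R]_n -> R) : Prop :=
  (forall x, differentiable f x) /\ continuous (grad f).

Definition lipschitz_grad (R : realType) (n : nat) (L : R)
    (f : 'cV[R]_n -> R) : Prop :=
  forall x y, enorm (grad f x - grad f y) <= L * enorm (x - y).

(* No second derivative is required; see hessian_strongly_convex below for
   the case of a twice differentiable function. *)
Definition strongly_convex (R : realType) (n : nat) (mu : R)
    (f : 'cV[R]_n -> R) : Prop :=
  forall (x y : 'cV[R]_n) (t : R), 0 <= t <= 1 ->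
    f (t *: x + (1 - t) *: y) <=
      t * f x + (1 - t) * f y - mu / 2 * (t * (1 - t)) * enorm (x - y) ^+ 2.

Definition hessian (R : realType) (n : nat) (f : 'cV[R]_n -> R)
    (x : 'cV[R]_n) : 'M[R]_n :=
  \matrix_(i, j) 'D_(delta_mx j 0) (fun y => grad f y i 0) x.

Definition psd (R : realType) (n : nat) (M : 'M[R]_n) : Prop :=
  forall v : 'cV[R]_n, 0 <= dotv v (M *m v).

(* Junk value 0 when there is no minimizer. *)
Definition argmin (R : realType) (n : nat) (g : 'cV[R]_n -> R) : 'cV[R]_n :=
  xget 0 [set x | forall y, g x <= g y].

Definition minval (R : realType) (n : nat) (g : 'cV[R]_n -> R) : R :=
  inf (range g).

Definition proj (R : realType) (n : nat) (X : set 'cV[R]_n) (y : 'cV[R]_n) :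
  'cV[R]_n :=
  xget 0 [set z | X z /\ forall w, X w -> enorm (y - z) <= enorm (y - w)].

Section problem.
Context {R : realType} {m n : nat}.
Variables (f : 'cV[R]_n -> R) (A : 'M[R]_(m, n)) (b : 'cV[R]_m).

Definition constr (x : 'cV[R]_n) : 'cV[R]_m := A *m x - b.

Definition lag (x : 'cV[R]_n) (lam : 'cV[R]_m) : R :=
  f x - dotv lam (constr x).

Definition grad_lag (x : 'cV[R]_n) (lam : 'cV[R]_m) : 'cV[R]_n :=
  grad (fun y => lag y lam) x.

Definition auglag (alpha : R) (x : 'cV[R]_n) (lam : 'cV[R]_m) : R :=
  f x - dotv lam (constr x) + alpha / 2 * enorm (constr x) ^+ 2.

Definition grad_auglag (alpha : R) (x : 'cV[R]_n) (lam : 'cV[R]_m) :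
  'cV[R]_n := grad (fun y => auglag alpha y lam) x.

Definition negdual (lam : 'cV[R]_m) : R := - minval (fun x => lag x lam).

Definition moreau_negdual (alpha : R) (u : 'cV[R]_m) : R :=
  minval (fun lam => negdual lam + (2 * alpha)^-1 * enorm (lam - u) ^+ 2).

Definition residual (X : set 'cV[R]_n) (alpha eta : R)
    (x : 'cV[R]_n) (lam : 'cV[R]_m) : 'cV[R]_n :=
  eta^-1 *: (proj X (x - eta *: grad_auglag alpha x lam) - x).

End problem.

Section method.
Context {R : realType} {m n : nat} {d dXi : measure_display}
  {Omega : measurableType d} {Xi : nat -> measurableType dXi}.

(* xi j carries all the randomness of outer iteration j, so this is the
   information available before outer iteration k; history xi 0 is trivial. *)
Definition history (xi : forall k, Omega -> Xi k) (k : nat) : set (set Omega) :=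
  <<s \bigcup_(j in [set j | (j < k)%N])
        preimage_set_system setT (xi j) measurable >>.

Definition previous (xinit : 'cV[R]_n) (x : nat -> Omega -> 'cV[R]_n)
    (k : nat) (w : Omega) : 'cV[R]_n :=
  if k is j.+1 then x j w else xinit.

(* xinit is the paper's x_{-1}.  The solver of outer iteration k maps the
   starting point, the current multiplier and the randomness xi k to an
   approximate minimizer. *)
Record inexact_alm (A : 'M[R]_(m, n)) (b : 'cV[R]_m) (alpha : R)
    (xi : forall k, Omega -> Xi k)
    (solver : forall k, 'cV[R]_n -> 'cV[R]_m -> Xi k -> 'cV[R]_n)
    (xinit : 'cV[R]_n) (lam0 : 'cV[R]_m)
    (x : nat -> Omega -> 'cV[R]_n) (lam : nat -> Omega -> 'cV[R]_m) : Prop := {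
  alm_randomness : forall k, measurable_fun setT (xi k) ;
  alm_lam0 : forall w, lam 0%N w = lam0 ;
  alm_primal : forall k w,
    x k w = solver k (previous xinit x k w) (lam k w) (xi k w) ;
  alm_primal_measurable : forall k i (B : set R), measurable B ->
    history xi k.+1 [set w | B (x k w i 0)] ;
  alm_dual : forall k w,
    lam k.+1 w = lam k w - alpha *: constr A b (x k w)
}.

(* Y is a version of the conditional expectation E[Z | G] of the nonnegative
   random variable Z; since Z need not be integrable, Y may take value +oo. *)
Record cond_expectation_nneg (P : probability Omega R) (G : set (set Omega))
    (Z : Omega -> R) (Y : Omega -> \bar R) : Prop := {
  condexp_ge0 : forall w, (0 <= Y w)%E ;
  condexp_measurable : forall B : set (\bar R), measurable B ->
    G (Y @^-1` B) ;
  condexp_integral : forall B : set Omega, G B ->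
    (\int[P]_(w in B) Y w = \int[P]_(w in B) (Z w)%:E)%E
}.

End method.

Section hessian_strongly_convex.
Variables (R : realType) (n : nat).
Implicit Types (f : 'cV[R]_n -> R) (x y v : 'cV[R]_n).

Let dotvDl (u v w : 'cV[R]_n) : dotv (u + v) w = dotv u w + dotv v w.
Proof.
by rewrite /dotv -big_split; apply: eq_bigr => i _; rewrite mxE mulrDl.
Qed.

Let dotvZl (a : R) (u v : 'cV[R]_n) : dotv (a *: u) v = a * dotv u v.
Proof.
by rewrite /dotv mulr_sumr; apply: eq_bigr => i _; rewrite mxE mulrA.
Qed.

Let dotvC (u v : 'cV[R]_n) : dotv u v = dotv v u.
Proof. by apply: eq_bigr => i _; rewrite mulrC. Qed.

Let dotv_ge0 (u : 'cV[R]_n) : 0 <= dotv u u.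
Proof. by apply: sumr_ge0 => i _; rewrite -expr2 sqr_ge0. Qed.

Let enorm2 (u : 'cV[R]_n) : enorm u ^+ 2 = dotv u u.
Proof. by rewrite sqr_sqrtr. Qed.

Let cV_delta v : v = \sum_i v i 0 *: delta_mx i 0.
Proof.
by rewrite {1}[v]matrix_sum_delta; apply: eq_bigr => i _; rewrite big_ord1.
Qed.

Let derive_coord (g : 'cV[R]_n -> R) x v : differentiable g x ->
  'D_v g x = \sum_i v i 0 * 'D_(delta_mx i 0) g x.
Proof.
move=> dg; rewrite deriveE// {1}[v]cV_delta linear_sum/=.
by apply: eq_bigr => i _; rewrite linearZ/= deriveE.
Qed.

Let is_derive_line (g : 'cV[R]_n -> R) x v (s : R) :
  differentiable g (x + s *: v) ->
  is_derive s 1 (fun s : R => g (x + s *: v)) ('D_v g (x + s *: v)).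
Proof.
move=> dg; pose l (s : R) := x + s *: v.
have dl : is_diff s l ( *:%R^~ v).
  have -> : l = cst x + *:%R^~ v by apply/funext.
  apply: (is_diff_eq (is_diffD (is_diff_cst x s) (is_diff_scalel s v))).
  exact: add0r.
have dls : differentiable l s := @ex_diff _ _ _ _ _ _ _ dl.
have dc : differentiable (g \o l) s by exact: differentiable_comp.
apply: DeriveDef; first exact/derivable1_diffP.
change ('D_1 (g \o l) s = 'D_v g (l s)).
rewrite deriveE// diff_comp// deriveE//=.
by rewrite (@diff_val _ _ _ _ _ _ _ dl) scale1r.
Qed.

Let MVT01 (g dg : R -> R) : (forall s : R, is_derive s 1 g (dg s)) ->
  exists2 c, 0 < c & g 1 - g 0 = dg c.
Proof.
move=> gd.
have cg : {within `[0, 1], continuous g}.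
  apply: derivable_within_continuous => s _.
  exact: (@ex_derive _ _ _ _ _ _ _ (gd s)).
have [c + ->] := MVT ltr01 (fun s _ => gd s) cg.
by rewrite in_itv/= subr0 mulr1 => /andP[c0 _]; exists c.
Qed.

(* This recovers the characterization of mu-strong convexity of a twice
   differentiable function by a lower bound mu on its Hessian. *)
Lemma hessian_strongly_convex (mu : R) f :
  (forall x, differentiable f x) -> (forall x, differentiable (grad f) x) ->
  (forall x, psd (hessian f x - mu%:M)) -> strongly_convex mu f.
Proof.
move=> df ddf psdH.
have grad1 x v : 'D_v f x = dotv (grad f x) v.
  by rewrite derive_coord// dotvC; apply: eq_bigr => i _; rewrite mxE.
have dgi x i : differentiable (fun y => grad f y i 0) x.
  exact: (differentiable_comp (ddf x) (differentiable_coord _ _ _)).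
have mono1 x v : mu * dotv v v <= dotv (grad f (x + v)) v - dotv (grad f x) v.
  pose g s := dotv (grad f (x + s *: v)) v.
  pose dg s := dotv v (hessian f (x + s *: v) *m v).
  have gd (s : R) : is_derive s 1 g (dg s).
    have -> : g = \sum_(i < n) (fun s : R => v i 0 *: grad f (x + s *: v) i 0).
      apply/funext => r; rewrite fct_sumE /g dotvC.
      by apply: eq_bigr => i _.
    have -> : dg s = \sum_(i < n)
        v i 0 *: 'D_v (fun y => grad f y i 0) (x + s *: v).
      apply: eq_bigr => i _; congr (_ * _); rewrite mxE derive_coord//.
      by apply: eq_bigr => j _; rewrite mxE mulrC.
    apply: is_derive_sum => i.
    exact: (is_deriveZ _ (is_derive_line (dgi (x + s *: v) i))).
  have [c _] := MVT01 gd.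
  rewrite /g scale1r scale0r addr0 => ->.
  have := psdH (x + c *: v) v.
  rewrite mulmxBl mul_scalar_mx dotvC dotvDl -scaleNr dotvZl.
  by rewrite mulNr subr_ge0 [dotv (_ *m _) _]dotvC.
have mono x v (s : R) : 0 <= s ->
    mu * s * dotv v v <= dotv (grad f (x + s *: v)) v - dotv (grad f x) v.
  rewrite le_eqVlt => /predU1P[<-|s0].
    by rewrite mulr0 mul0r scale0r addr0 subrr.
  have := mono1 x (s *: v); rewrite !(dotvC _ (s *: v)) !dotvZl.
  rewrite (dotvC v (s *: v)) dotvZl !(dotvC v (grad _ _)) -mulrBr => h.
  rewrite -(ler_pM2l s0); apply: le_trans h.
  by rewrite le_eqVlt; apply/orP; left; apply/eqP; ring.
have first x v : f x + dotv (grad f x) v + mu / 2 * dotv v v <= f (x + v).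
  pose h s := f (x + s *: v) - (s * dotv (grad f x) v + mu / 2 * dotv v v * s ^+ 2).
  pose dh s := dotv (grad f (x + s *: v)) v
    - (dotv (grad f x) v + mu / 2 * dotv v v * (2 * s)).
  have hd (s : R) : is_derive s 1 h (dh s).
    apply: is_deriveB.
      by have := is_derive_line (df (x + s *: v)); rewrite grad1.
    set a := dotv _ _; set c := (X in X * _).
    apply: is_derive_eq; rewrite /GRing.scale/=; ring.
  have [c c0 hc] := MVT01 hd.
  have := mono x v c (ltW c0).
  move: hc; rewrite /h /dh scale1r scale0r addr0.
  lra.
move=> x y t /andP[t0 t1]; set z := t *: x + (1 - t) *: y.
have hx := first z ((1 - t) *: (x - y)).
have hy := first z ((- t) *: (x - y)).
have ex : z + (1 - t) *: (x - y) = x.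
  by apply/colP => i; rewrite !mxE; ring.
have ey : z + (- t) *: (x - y) = y.
  by apply/colP => i; rewrite !mxE; ring.
move: hx hy; rewrite ex ey enorm2.
rewrite !(dotvC (grad f z)) !dotvZl !(dotvC (x - y) (_ *: _)) !dotvZl.
move: (dotv (x - y) (grad f z)) (dotv (x - y) (x - y)) => p q hx hy.
have t1' : 0 <= 1 - t by rewrite subr_ge0.
have := ler_wpM2l t0 hx; have := ler_wpM2l t1' hy; lra.
Qed.

End hessian_strongly_convex.

(* Main.v *)
Require Import Defs.
From mathcomp Require Import all_boot all_order all_algebra.
From mathcomp Require Import all_classical all_reals all_analysis measurable_realfun.
From mathcomp Require Import ring lra.

Set Implicit Arguments.
Unset Strict Implicit.
Unset Printing Implicit Defensive.

Import Order.TTheory GRing.Theory Num.Theory.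
Import numFieldNormedType.Exports.

Local Open Scope classical_set_scope.
Local Open Scope ring_scope.

(** The outer iteration is an inexact gradient method on the Moreau envelope
    [q_alpha] of the negative dual function [q], and strong convexity makes it
    contract.

    Let [x] minimize the augmented Lagrangian for the multiplier [u], let [c] be
    the constraint violation at [x], and put [p = u - alpha *: c].  Stationarity
    reads [grad f x = A^T *m p], so that [x] also minimizes the Lagrangian for
    [p].  Hence [c] is a subgradient of [q] at [p], [p] is the proximal point of
    [u], and [c] is the gradient of [q_alpha] at [u].  It acts as a
    gradient through two inequalities: the quadratic upper bound
    [moreau_smooth], with modulus [alpha^-1], and the quadratic lower bound
    [moreau_tangent], with modulus [mu_moreau].  The lower bound comes from
    [negdual_strongly_convex], where the descent lemma for [f] and the smallest
    eigenvalue of [A *m A^T] enter.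

    The exact dual step lowers [q_alpha] by [alpha / 2] times the squared norm
    of [c]; a step with the violation at an inexact minimizer loses [alpha / 2]
    times the squared error ([moreau_dual_step]).  The squared norm of [c]
    dominates the gap of [q_alpha] by [moreau_gradient_dominated] and is
    dominated by it by [cmin_le_gap].  The error on [c] is at most
    [mxnorm2 A / mu] times the gradient of the augmented Lagrangian
    ([constr_error]), and this gradient is what the inexactness condition
    controls.

    Averaging over the whole probability space turns the conditional
    inexactness condition into an inequality between plain means, so that the
    mean gap satisfies a scalar recursion ([expected_step],
    [gap_contraction]).  The minimizer depends on the multiplier in a Lipschitz
    way, which makes every random variable involved measurable.  The two bounds
    of the theorem follow from the bound on the mean gap, the second one because
    after the multiplier update the gradient of the Lagrangian is that of the
    augmented Lagrangian ([grad_lag_update]). *)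

(** * Euclidean geometry of column vectors *)

Section euclidean.
Variable R : realType.
Implicit Types m n : nat.

Lemma dotvDl n (u v w : 'cV[R]_n) : dotv (u + v) w = dotv u w + dotv v w.
Proof.
by rewrite /dotv -big_split; apply: eq_bigr => i _; rewrite mxE mulrDl.
Qed.

Lemma dotvZl n (c : R) (u v : 'cV[R]_n) : dotv (c *: u) v = c * dotv u v.
Proof.
by rewrite /dotv mulr_sumr; apply: eq_bigr => i _; rewrite mxE mulrA.
Qed.

Lemma dotvC n (u v : 'cV[R]_n) : dotv u v = dotv v u.
Proof. by apply: eq_bigr => i _; rewrite mulrC. Qed.

Lemma dotvDr n (u v w : 'cV[R]_n) : dotv w (u + v) = dotv w u + dotv w v.
Proof. by rewrite dotvC dotvDl !(dotvC w). Qed.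

Lemma dotvZr n (c : R) (u v : 'cV[R]_n) : dotv u (c *: v) = c * dotv u v.
Proof. by rewrite dotvC dotvZl dotvC. Qed.

Lemma dotvNl n (u v : 'cV[R]_n) : dotv (- u) v = - dotv u v.
Proof. by rewrite -scaleN1r dotvZl mulN1r. Qed.

Lemma dotvNr n (u v : 'cV[R]_n) : dotv u (- v) = - dotv u v.
Proof. by rewrite dotvC dotvNl dotvC. Qed.

Lemma dot0v n (u : 'cV[R]_n) : dotv 0 u = 0.
Proof. by rewrite -(scale0r 0) dotvZl mul0r. Qed.

Lemma dotv0 n (u : 'cV[R]_n) : dotv u 0 = 0.
Proof. by rewrite dotvC dot0v. Qed.

Definition dotvE := (dotvDl, dotvDr, dotvNl, dotvNr, dotvZl, dotvZr).

Lemma dotv_ge0 n (u : 'cV[R]_n) : 0 <= dotv u u.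
Proof. by apply: sumr_ge0 => i _; rewrite -expr2 sqr_ge0. Qed.

Lemma sqr_enorm n (u : 'cV[R]_n) : enorm u ^+ 2 = dotv u u.
Proof. by rewrite sqr_sqrtr ?dotv_ge0. Qed.

Lemma enorm_ge0 n (u : 'cV[R]_n) : 0 <= enorm u.
Proof. exact: sqrtr_ge0. Qed.

Lemma coord_le_dotv n (u : 'cV[R]_n) i : u i 0 ^+ 2 <= dotv u u.
Proof.
rewrite /dotv (bigD1 i)//= expr2 lerDl.
by apply: sumr_ge0 => j _; rewrite -expr2 sqr_ge0.
Qed.

Lemma dotv_eq0 n (u : 'cV[R]_n) : dotv u u <= 0 -> u = 0.
Proof.
move=> u0; apply/colP => i; rewrite mxE; apply/eqP; rewrite -sqrf_eq0.
by rewrite eq_le sqr_ge0 andbT (le_trans (coord_le_dotv u i)).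
Qed.

Lemma dotv_mulmx m n (A : 'M[R]_(m, n)) u v :
  dotv (A *m u) v = dotv u (A^T *m v).
Proof.
have dotvM k (y z : 'cV[R]_k) : (y^T *m z) 0 0 = dotv y z.
  by rewrite !mxE; apply: eq_bigr => i _; rewrite mxE.
by rewrite -!dotvM trmx_mul mulmxA.
Qed.

Lemma cauchy_schwarz n (u v : 'cV[R]_n) :
  dotv u v ^+ 2 <= dotv u u * dotv v v.
Proof.
have [v0|v0] := leP (dotv v v) 0.
  by rewrite (dotv_eq0 v0) !dotv0 mulr0 expr0n.
rewrite -subr_ge0 -(pmulr_rge0 _ v0).
have := dotv_ge0 (dotv v v *: u - dotv u v *: v).
by rewrite !dotvE !(dotvC v u) => h; apply: le_trans h _; lra.
Qed.

Lemma dotv_le_enorm n (u v : 'cV[R]_n) : dotv u v <= enorm u * enorm v.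
Proof.
rewrite (le_trans (ler_norm _))// -(@ler_pXn2r _ 2) ?nnegrE//; last first.
  by rewrite mulr_ge0 ?enorm_ge0.
by rewrite exprMn !sqr_enorm real_normK ?num_real// cauchy_schwarz.
Qed.

Lemma enormZ n (c : R) (u : 'cV[R]_n) : enorm (c *: u) = `|c| * enorm u.
Proof.
by rewrite /enorm dotvZl dotvZr mulrA -expr2 sqrtrM ?sqr_ge0// sqrtr_sqr.
Qed.

Lemma dotv_addN_le n (u v : 'cV[R]_n) :
  dotv u u <= 2 * dotv v v + 2 * dotv (u - v) (u - v).
Proof.
have := dotv_ge0 (u - 2 *: v).
by rewrite !dotvE !(dotvC v u); lra.
Qed.

(** The norm on the left is the max norm, which defines the topology; with
    [enorm_le_normr] it is equivalent to the Euclidean norm. *)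
Lemma normr_le_enorm n (u : 'cV[R]_n) : `|u| <= enorm u.
Proof.
rewrite /Num.norm/= mx_normrE; apply/bigmax_leP; split; first exact: enorm_ge0.
move=> [i j] _ /=; rewrite (ord1 j) -sqrtr_sqr; apply: ler_wsqrtr.
exact: coord_le_dotv.
Qed.

Lemma coord_le_normr n (u : 'cV[R]_n) i : `|u i 0| <= `|u|.
Proof.
by rewrite [leRHS]/Num.norm/= mx_normrE; apply/bigmax_geP; right; exists (i, 0).
Qed.

Lemma enorm_le_normr n (u : 'cV[R]_n) : enorm u <= n%:R * `|u|.
Proof.
rewrite -(@ler_pXn2r _ 2) ?nnegrE ?mulr_ge0 ?enorm_ge0//.
rewrite sqr_enorm exprMn (@le_trans _ _ (n%:R * `|u| ^+ 2))//; last first.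
  rewrite ler_wpM2r ?sqr_ge0// -natrX ler_nat.
  by case: (n) => // k; rewrite expnS expn1 leq_pmulr.
apply: (@le_trans _ _ (\sum_(i < n) `|u| ^+ 2)).
  apply: ler_sum => i _; rewrite -expr2 -[u i 0 ^+ 2]real_normK ?num_real//.
  by rewrite ler_pXn2r ?nnegrE// coord_le_normr.
by rewrite sumr_const card_ord mulr_natl.
Qed.

Lemma continuous_coord m n (g : 'cV[R]_m -> 'cV[R]_n) i :
  continuous g -> continuous (fun u => g u i 0).
Proof.
move=> cg u; apply: (@continuous_comp _ _ _ g (fun y : 'cV[R]_n => y i 0)).
  exact: cg.
exact: coord_continuous.
Qed.

Lemma dotv_continuous m n (g h : 'cV[R]_m -> 'cV[R]_n) :
  continuous g -> continuous h -> continuous (fun u => dotv (g u) (h u)).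
Proof.
move=> cg ch; rewrite /dotv; apply: continuous_big => [|i _ u].
  exact: add_continuous.
apply: (@continuousM _ _ (fun u => g u i 0) (fun u => h u i 0)).
  exact: continuous_coord.
exact: continuous_coord.
Qed.

Lemma continuous_colP m n (g : 'cV[R]_m -> 'cV[R]_n) :
  (forall i, continuous (fun u => g u i 0)) -> continuous g.
Proof.
move=> cg u; apply/(@cvgrPdist_le _ _ _ (nbhs u) (nbhs_filter u)) => /= e e0.
have : \forall v \near u, forall i, `|g u i 0 - g v i 0| <= e.
  apply: (@filter_forall _ _ _ (nbhs u) (nbhs_filter u)) => i.
  by move/(@cvgrPdist_le _ _ _ (nbhs u) (nbhs_filter u)): (cg i u); exact.
apply: filterS => v h; rewrite /Num.norm/= mx_normrE; apply/bigmax_leP.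
by split; [exact: ltW|move=> [i j] _ /=; rewrite (ord1 j) !mxE].
Qed.

Lemma lipschitz_continuous m n (k : R) (g : 'cV[R]_m -> 'cV[R]_n) :
  (forall u v, enorm (g u - g v) <= k * enorm (u - v)) -> continuous g.
Proof.
move=> gk u; apply/(@cvgrPdist_le _ _ _ (nbhs u) (nbhs_filter u)) => e e0.
pose c := `|k| * m%:R + 1.
have c0 : 0 < c by rewrite ltr_pwDr// mulr_ge0.
have /(@cvgrPdist_le _ _ _ (nbhs u) (nbhs_filter u))/(_ (e / c)) :=
  @cvg_id _ (nbhs u).
rewrite divr_gt0// => /(_ isT); apply: filterS => v /=.
rewrite ler_pdivlMr// => uv; apply: le_trans (normr_le_enorm _) _.
apply: le_trans (gk u v) _; apply: le_trans uv.
apply: (@le_trans _ _ (`|k| * (m%:R * `|u - v|))).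
  apply: le_trans (ler_wpM2r (enorm_ge0 _) (ler_norm k)) _.
  by rewrite ler_wpM2l ?enorm_le_normr.
by rewrite mulrA mulrC ler_wpM2l// lerDl.
Qed.

Lemma mulmx_continuous m n k (A : 'M[R]_(m, n)) (g : 'cV[R]_k -> 'cV[R]_n) :
  continuous g -> continuous (fun u => A *m g u).
Proof.
move=> cg; apply: continuous_colP => i.
rewrite (_ : (fun u => _) = fun u => dotv (row i A)^T (g u)); last first.
  apply/funext => u; rewrite mxE; apply: eq_bigr => j _.
  by rewrite !mxE.
apply: dotv_continuous cg; exact: cst_continuous.
Qed.

End euclidean.

(** * Minimizers in finite dimension *)

Section minimizers.
Variable R : realType.

(** The Heine-Borel property of row vectors is carried over to column vectors by
    transposition, which is continuous and does not change the max norm. *)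
Lemma compact_min_cV n (g : 'cV[R]_n -> R) (K : set 'cV[R]_n) (r : R) :
  K !=set0 -> closed K -> (forall v, K v -> `|v| <= r) -> continuous g ->
  exists2 x, K x & forall y, K y -> g x <= g y.
Proof.
move=> K0 Kcl Kr cg.
have norm_tr p q (v : 'M[R]_(p, q)) : `|v^T| <= `|v|.
  rewrite {1}/Num.norm/= mx_normrE; apply/bigmax_leP; split => // -[i j] _ /=.
  rewrite mxE [leRHS]/Num.norm/= mx_normrE.
  by apply/bigmax_geP; right; exists (j, i).
have trc p q : continuous (fun v : 'M[R]_(p, q) => v^T).
  move=> u; apply/(@cvgrPdist_le _ _ _ (nbhs u) (nbhs_filter u)) => e e0.
  have /(@cvgrPdist_le _ _ _ (nbhs u) (nbhs_filter u))/(_ e e0) := @cvg_id _ (nbhs u).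
  apply: filterS => v; apply: le_trans; rewrite -linearB.
  exact: norm_tr.
have Kc : compact K.
  have -> : K = (fun v : 'rV[R]_n => v^T) @` [set v | K v^T].
    apply/seteqP; split => [v Kv|_ [v Kv <-]//].
    by exists v^T; rewrite /= trmxK.
  apply: continuous_compact; first exact: (continuous_subspaceT (trc 1%N n)).
  apply: bounded_closed_compact.
    exists r; split; first exact: num_real.
    move=> s rs v /Kr vr; apply: le_trans (ltW rs).
    by apply: le_trans vr; rewrite -{1}[v]trmxK norm_tr.
  exact: (proj1 (continuous_closedP _) (trc 1%N n)).
have [x xK xmin] := compact_EVT_min K0 Kc (continuous_subspaceT cg).
exists x; first by rewrite inE in xK.
by move=> y Ky; apply: xmin; rewrite inE.
Qed.

(** A linear term cannot compensate a quadratic one far away, so that outside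
    of a ball [g] exceeds [g x0]. *)
Lemma coercive_min n (g : 'cV[R]_n -> R) (x0 c : 'cV[R]_n) (s : R) :
  continuous g -> 0 < s ->
  (forall y, g x0 + dotv c (y - x0) + s / 2 * enorm (y - x0) ^+ 2 <= g y) ->
  exists x, forall y, g x <= g y.
Proof.
move=> cg s0 gl.
(* Beyond this distance the quadratic term exceeds the linear one. *)
pose r := 2 * enorm c / s.
have r0 : 0 <= r by rewrite divr_ge0 ?mulr_ge0 ?enorm_ge0 ?(ltW s0).
pose K := [set y : 'cV[R]_n | `|y - x0| <= r].
have Kcl : closed K.
  have -> : K = (fun y => `|y - x0|) @^-1` [set t | t <= r] by [].
  apply: (proj1 (continuous_closedP _)) (@closed_le _ r) => y.
  apply: continuous_comp; last exact: norm_continuous.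
  apply: (@continuousB _ _ _ id (cst x0)).
    by [].
  exact: cst_continuous.
have Kx0 : K x0 by rewrite /K/= subrr normr0.
have Kr v : K v -> `|v| <= r + `|x0|.
  by move=> Kv; rewrite -[v](subrK x0) (le_trans (ler_normD _ _))// lerD2r.
have [x Kx xmin] := compact_min_cV (ex_intro _ x0 Kx0) Kcl Kr cg.
exists x => y; have [yr|yr] := leP `|y - x0| r; first exact: xmin.
apply: le_trans (xmin _ Kx0) _; apply: le_trans (gl y).
rewrite -addrA lerDl.
have h1 : r < enorm (y - x0) := lt_le_trans yr (normr_le_enorm _).
have := dotv_le_enorm (- c) (y - x0).
rewrite dotvNl {1}/enorm dotvNl dotvNr opprK -/(enorm c).
move: h1; rewrite /r ltr_pdivrMr//.
set E := enorm (y - x0); set C := enorm c; set D := dotv _ _.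
have E0 : 0 <= E := enorm_ge0 _; nra.
Qed.

(** The derivative at 0 of the right-hand side vanishes. *)
Lemma le0_linear_quadratic (p q : R) :
  (forall t, 0 < t <= 1 -> t * p <= t ^+ 2 * q) -> p <= 0.
Proof.
move=> h; rewrite leNgt; apply/negP => p0.
have q0 : 0 < q.
  by have := h 1; rewrite ltr01 lexx/= expr1n !mul1r => /(_ isT); exact: lt_le_trans.
(* Half of the ratio at which the two sides would balance. *)
pose t := Num.min 1 (p / (2 * q)).
have pq0 : 0 < p / (2 * q) by rewrite divr_gt0 ?mulr_gt0.
have t01 : 0 < t <= 1 by rewrite /t lt_min ltr01 pq0 ge_min lexx.
have /andP[t0 _] := t01.
have := h t t01; rewrite expr2 -mulrA ler_pM2l// leNgt => /negP; apply.
apply: (@le_lt_trans _ _ (p / 2)); last by lra.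
have : t <= p / (2 * q) by rewrite /t ge_min lexx orbT.
by rewrite ler_pdivlMr ?mulr_gt0//; lra.
Qed.

Lemma minvalE n (g : 'cV[R]_n -> R) x : (forall y, g x <= g y) -> minval g = g x.
Proof.
move=> gx; apply/eqP; rewrite eq_le; apply/andP; split.
  by apply: ge_inf; [exists (g x) => _ [y _ <-]|exists x].
by apply: lb_le_inf; [exists (g x); exists x|move=> _ [y _ <-]].
Qed.

Lemma argmin_le n (g : 'cV[R]_n -> R) : (exists x, forall y, g x <= g y) ->
  forall y, g (argmin g) <= g y.
Proof. by move=> /(@xgetPex _ 0 [set x | forall y, g x <= g y]). Qed.

End minimizers.

(** * Smallest eigenvalue and matrix norm *)

Section matrix_bounds.
Variables (R : realType) (m n : nat) (A : 'M[R]_(m, n)).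
Let M := A *m A^T.

Let trM : M^T = M. Proof. by rewrite trmx_mul trmxK. Qed.

Lemma dotv_gram (v : 'cV[R]_m) : dotv v (M *m v) = dotv (A^T *m v) (A^T *m v).
Proof. by rewrite -mulmxA dotvC dotv_mulmx. Qed.

Lemma eigenvalue_gram_ge0 (s : R) : eigenvalue M s -> 0 <= s.
Proof.
move=> /eigenvalueP[v vM v0].
have Mv : M *m v^T = s *: v^T.
  by rewrite -[LHS]trmxK trmx_mul trmxK trM vM linearZ.
have := dotv_ge0 (A^T *m v^T); rewrite -dotv_gram Mv dotvZr.
rewrite pmulr_lge0// lt_neqAle dotv_ge0 andbT eq_sym.
by apply: contra_neq v0 => v0; rewrite -[v]trmxK (@dotv_eq0 _ _ v^T) ?v0 ?trmx0.
Qed.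

(** The Rayleigh quotient attains its minimum on the unit sphere, and there its
    first variation vanishes, which makes the minimizer an eigenvector. *)
Lemma lambda_min_gram (v : 'cV[R]_m) :
  lambda_min M * dotv v v <= dotv (A^T *m v) (A^T *m v).
Proof.
have [v0|v0] := leP (dotv v v) 0.
  by rewrite (dotv_eq0 v0) dotv0 mulr0 dotv_ge0.
pose Q (u : 'cV[R]_m) := dotv (A^T *m u) (A^T *m u).
have idc : continuous (fun u : 'cV[R]_m => u) by move=> u.
have Qc : continuous Q by apply: dotv_continuous; exact: mulmx_continuous.
pose S := [set u : 'cV[R]_m | dotv u u = 1].
have QZ c u : Q (c *: u) = c ^+ 2 * Q u.
  by rewrite /Q -scalemxAr dotvZl dotvZr mulrA.
pose k := (Num.sqrt (dotv v v))^-1.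
have k2 : k ^+ 2 * dotv v v = 1.
  by rewrite exprVn sqr_sqrtr ?(ltW v0)// mulVf ?gt_eqF.
have unit_scale u : 0 < dotv u u -> S ((Num.sqrt (dotv u u))^-1 *: u).
  move=> u0; rewrite /S/= dotvZl dotvZr mulrA -expr2 exprVn.
  by rewrite sqr_sqrtr ?(ltW u0)// mulVf ?gt_eqF.
have Scl : closed S.
  have -> : S = (fun u => dotv u u) @^-1` [set 1] by [].
  apply: (proj1 (continuous_closedP _)) (@closed_eq _ 1).
  exact: dotv_continuous.
have Sb u : S u -> `|u| <= 1.
  by move=> Su; rewrite (le_trans (normr_le_enorm _))// /enorm Su sqrtr1.
have [u Su umin] := compact_min_cV (ex_intro _ _ (unit_scale _ v0)) Scl Sb Qc.
have Qge w : Q u * dotv w w <= Q w.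
  have [w0|w0] := leP (dotv w w) 0.
    by rewrite (dotv_eq0 w0) dotv0 mulr0 dotv_ge0.
  have := umin _ (unit_scale _ w0); rewrite QZ exprVn sqr_sqrtr ?(ltW w0)//.
  by rewrite ler_pdivlMl// mulrC.
(* The form [Q w - Q u * dotv w w] is nonnegative and vanishes at [w = u];
   varying [u] along the defect [g] of the eigenvector equation forces
   [g = 0]. *)
have eigu : M *m u = Q u *: u.
  apply/subr0_eq; have [g gE] : exists g, g = M *m u - Q u *: u by eexists.
  rewrite -gE; apply: dotv_eq0.
  suff : 2 * dotv g g <= 0 by rewrite pmulr_rle0.
  apply: (@le0_linear_quadratic _ _ (Q g - Q u * dotv g g)) => t _.
  have := Qge (u - t *: g); rewrite {2}/Q mulmxBr -scalemxAr.
  rewrite !dotvE (dotvC g u) (dotvC (A^T *m g)) Su -!/(Q _).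
  have -> : dotv (A^T *m u) (A^T *m g) = dotv g (M *m u).
    by rewrite dotvC dotv_mulmx trmxK mulmxA.
  have -> : dotv g g = dotv g (M *m u) - Q u * dotv g u.
    by rewrite {2}gE !dotvE.
  by rewrite (dotvC g u); lra.
have eig : eigenvalue M (Q u).
  apply/eigenvalueP; exists u^T.
    by rewrite -[LHS]trmxK trmx_mul trmxK trM eigu linearZ.
  apply/eqP => /(congr1 trmx); rewrite trmxK trmx0 => u0.
  by move: Su; rewrite /S/= u0 dotv0 => /esym/eqP; rewrite oner_eq0.
apply: le_trans (Qge v); rewrite ler_wpM2r ?dotv_ge0//.
by apply: ge_inf eig; exists 0 => s; exact: eigenvalue_gram_ge0.
Qed.

Lemma lambda_min_gram_gt0_neq0 : 0 < lambda_min M ->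
  exists v : 'cV[R]_m, A^T *m v != 0.
Proof.
move=> s0.
have [[s /eigenvalueP[v _ v0]]|none] := pselect (exists s, eigenvalue M s).
  exists v^T; apply/eqP => Av; have := lambda_min_gram v^T.
  rewrite Av dot0v pmulr_rle0// => /dotv_eq0 /(congr1 trmx).
  by rewrite trmxK trmx0 => v0'; rewrite v0' eqxx in v0.
move: s0; rewrite /lambda_min (_ : [set _ | _] = set0) ?inf0 ?ltxx//.
by rewrite -subset0 => s es; apply: none; exists s.
Qed.

Lemma mxnorm2_bound : has_ubound
  [set enorm (A *m v) | v in [set v : 'cV[R]_n | enorm v <= 1]].
Proof.
exists (Num.sqrt (\sum_i dotv (row i A)^T (row i A)^T)) => _ [v /= v1 <-].
apply: ler_wsqrtr; apply: ler_sum => i _.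
have -> : (A *m v) i 0 = dotv (row i A)^T v.
  by rewrite mxE; apply: eq_bigr => j _; rewrite !mxE.
rewrite -expr2 (le_trans (cauchy_schwarz _ _))// ler_piMr ?dotv_ge0//.
by rewrite -sqr_enorm expr_le1// enorm_ge0.
Qed.

Lemma mxnorm2_ge0 : 0 <= mxnorm2 A.
Proof.
apply: (@le_trans _ _ (enorm (A *m (0 : 'cV[R]_n)))); first exact: enorm_ge0.
apply: ub_le_sup; first exact: mxnorm2_bound.
by exists 0 => //=; rewrite /enorm dotv0 sqrtr0.
Qed.

Lemma enorm_mulmx_le (v : 'cV[R]_n) : enorm (A *m v) <= mxnorm2 A * enorm v.
Proof.
have [v0|v0] := leP (dotv v v) 0.
  by rewrite (dotv_eq0 v0) mulmx0 /enorm !dotv0 sqrtr0 mulr0.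
have e0 : 0 < enorm v by rewrite sqrtr_gt0.
rewrite -ler_pdivrMr//; apply: ub_le_sup; first exact: mxnorm2_bound.
exists ((enorm v)^-1 *: v) => /=.
  by rewrite enormZ gtr0_norm ?invr_gt0// mulVf// gt_eqF.
by rewrite -scalemxAr enormZ gtr0_norm ?invr_gt0// mulrC.
Qed.

End matrix_bounds.

(** * Gradients and smooth strongly convex functions *)

Section gradients.
Variables (R : realType) (n : nat).
Implicit Types (f : 'cV[R]_n -> R) (x v : 'cV[R]_n).

Lemma derive_grad f x v : differentiable f x -> 'D_v f x = dotv (grad f x) v.
Proof.
move=> df; rewrite deriveE//.
have {1}-> : v = \sum_i v i 0 *: delta_mx i 0.
  by rewrite {1}[v]matrix_sum_delta; apply: eq_bigr => i _; rewrite big_ord1.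
rewrite linear_sum/= dotvC; apply: eq_bigr => i _.
by rewrite linearZ/= mxE -deriveE.
Qed.

(** Both difference quotients are the same function of the increment. *)
Lemma is_derive_line f x v (s l : R) :
  is_derive (x + s *: v) v f l <->
  is_derive s 1 (fun t : R => f (x + t *: v)) l.
Proof.
have lineE : (fun h : R => h^-1 *: (f (x + (h *: 1 + s) *: v) - f (x + s *: v)))
    = (fun h : R => h^-1 *: (f (h *: v + (x + s *: v)) - f (x + s *: v))).
  by apply/funext => h; rewrite [h *: 1]mulr1 scalerDl addrCA.
split=> -[ex val]; apply: DeriveDef.
- by rewrite /derivable/= lineE.
- by rewrite /derive/= lineE.
- by move: ex; rewrite /derivable/= lineE.
- by move: val; rewrite /derive/= lineE.
Qed.

Lemma is_derive_grad_line f x v (s : R) : differentiable f (x + s *: v) ->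
  is_derive s 1 (fun t : R => f (x + t *: v)) (dotv (grad f (x + s *: v)) v).
Proof.
move=> df; rewrite -derive_grad//; apply/is_derive_line.
by apply: DeriveDef => //; exact/diff_derivable.
Qed.

(** Gradient of a sum with a quadratic function [q]; [e] is the quadratic form
    of [q]. *)
Lemma grad_add_quadratic f (q e : 'cV[R]_n -> R) x (c : 'cV[R]_n) :
  differentiable f x ->
  (forall (t : R) v, q (x + t *: v) = q x + t * dotv c v + t ^+ 2 * e v) ->
  grad (fun y => f y + q y) x = grad f x + c.
Proof.
move=> df qE.
have dq v : is_derive x v q (dotv c v).
  rewrite -[x]addr0 -[in X in _ + X](scale0r v); apply/is_derive_line.
  have -> : (fun t : R => q (x + t *: v)) =
      (fun t => q x + t * dotv c v + t ^+ 2 * e v) by exact/funext.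
  by apply: is_derive_eq; rewrite /GRing.scale/=; ring.
apply/colP => i; rewrite !mxE deriveD//; last exact/diff_derivable.
congr (_ + _); rewrite (@derive_val _ _ _ _ _ _ _ (dq _)).
rewrite /dotv (bigD1 i)//= mxE !eqxx mulr1 big1 ?addr0// => j ji.
by rewrite mxE (negbTE ji) mulr0.
Qed.

(** A first-order mean value inequality, with the constant 1/2 that plain mean
    value bounds lose. *)
Lemma increment_le (g dg : R -> R) (p q : R) :
  (forall s : R, is_derive s 1 g (dg s)) ->
  (forall s : R, 0 < s -> dg s <= p + q * s) -> g 1 - g 0 <= p + q / 2.
Proof.
move=> gd dgle.
pose h s := g s - (p * s + q / 2 * s ^+ 2).
pose dh s := dg s - (p + q * s).
have hd (s : R) : is_derive s 1 h (dh s).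
  by apply: is_derive_eq; rewrite /dh /GRing.scale/=; field.
have hc : {within `[0, 1], continuous h}.
  apply: derivable_within_continuous => s _.
  exact: (@ex_derive _ _ _ _ _ _ _ (hd s)).
have [c + hE] := MVT ltr01 (fun s _ => hd s) hc.
rewrite in_itv/= => /andP[c0 _]; move: hE (dgle c c0).
by rewrite /h /dh subr0 mulr1; lra.
Qed.

End gradients.

Section smooth_strongly_convex.
Variables (R : realType) (n : nat) (f : 'cV[R]_n -> R) (L mu : R).
Hypotheses (df : forall x, differentiable f x) (Lf : lipschitz_grad L f).
Hypothesis scf : strongly_convex mu f.

Lemma dotv_grad_lipschitz x v (s : R) : 0 < s ->
  `|dotv (grad f (x + s *: v)) v - dotv (grad f x) v| <= L * s * dotv v v.
Proof.
move=> s0.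
have bound (w : 'cV[R]_n) : enorm w = enorm v ->
    dotv (grad f (x + s *: v) - grad f x) w <= L * s * dotv v v.
  move=> wv; apply: (le_trans (dotv_le_enorm _ _)).
  have := Lf (x + s *: v) x; rewrite [_ + _ - x]addrAC subrr add0r enormZ (gtr0_norm s0) => h.
  rewrite wv -sqr_enorm expr2; have := ler_wpM2r (enorm_ge0 v) h; lra.
rewrite ler_norml; apply/andP; split; last first.
  by have := bound v erefl; rewrite !dotvE.
have := bound (- v); rewrite /enorm !dotvE opprK => /(_ erefl); lra.
Qed.

Lemma descent_lemma x v : f (x + v) <= f x + dotv (grad f x) v + L / 2 * dotv v v.
Proof.
have fd s := is_derive_grad_line (df (x + s *: v)).
have := @increment_le _ _ _ (dotv (grad f x) v) (L * dotv v v) fd.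
rewrite scale1r scale0r addr0 => h.
suff : f (x + v) - f x <= dotv (grad f x) v + L * dotv v v / 2 by lra.
apply: h => s s0; have := dotv_grad_lipschitz x v s0.
by rewrite ler_norml => /andP[_]; lra.
Qed.

Lemma ascent_lemma x v : f x + dotv (grad f x) v - L / 2 * dotv v v <= f (x + v).
Proof.
have fd s := is_deriveN (is_derive_grad_line (df (x + s *: v))).
have := @increment_le _ _ _ (- dotv (grad f x) v) (L * dotv v v) fd.
rewrite /= !fctE scale1r scale0r addr0 => h.
suff : - f (x + v) - - f x <= - dotv (grad f x) v + L * dotv v v / 2 by lra.
apply: h => s s0; have := dotv_grad_lipschitz x v s0.
by rewrite ler_norml => /andP[+ _]; lra.
Qed.

(** The tangent at [x] is compared with the chord to [x + v] near [x], where
    [ascent_lemma] replaces the limit of difference quotients. *)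
Lemma strongly_convex_tangent x v :
  f x + dotv (grad f x) v + mu / 2 * dotv v v <= f (x + v).
Proof.
rewrite -subr_le0.
apply: (@le0_linear_quadratic _ _ ((L / 2 + mu / 2) * dotv v v)) => t /andP[t0 t1].
have := ascent_lemma x (t *: v).
have := @scf (x + v) x t; rewrite (ltW t0) t1 => /(_ isT).
have -> : t *: (x + v) + (1 - t) *: x = x + t *: v.
  by apply/colP => i; rewrite !mxE; ring.
rewrite [x + v - x]addrAC subrr add0r sqr_enorm !dotvE; lra.
Qed.

Lemma grad_strongly_monotone x y :
  mu * dotv (x - y) (x - y) <= dotv (grad f x - grad f y) (x - y).
Proof.
have := strongly_convex_tangent y (x - y); have := strongly_convex_tangent x (y - x).
have subKC u v : u + (v - u) = v :> 'cV[R]_n by rewrite addrC subrK.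
rewrite !subKC -(opprB x y) !dotvE; lra.
Qed.

End smooth_strongly_convex.

(** * Augmented Lagrangian and Moreau envelope of the negative dual *)

Section augmented_lagrangian.
Variables (R : realType) (m n : nat).
Variables (f : 'cV[R]_n -> R) (A : 'M[R]_(m, n)) (b : 'cV[R]_m).
Variables (L mu alpha : R).
Hypotheses (df : forall x, differentiable f x) (Lf : lipschitz_grad L f).
Hypotheses (mu0 : 0 < mu) (scf : strongly_convex mu f) (alpha0 : 0 < alpha).
Hypothesis sigma0 : 0 < lambda_min (A *m A^T).

Implicit Types (x y : 'cV[R]_n) (u v lam : 'cV[R]_m).

Let constr := constr A b.

Lemma constrD x y : constr (x + y) = constr x + A *m y.
Proof. by rewrite /constr /Defs.constr mulmxDr addrAC. Qed.

Lemma constrB x y : constr x - constr y = A *m (x - y).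
Proof. by rewrite -{1}(subrK y x) [_ - y + y]addrC constrD addrC addKr. Qed.

Lemma grad_lagE x lam : grad_lag f A b x lam = grad f x - A^T *m lam.
Proof.
apply: (@grad_add_quadratic _ _ _ (fun y => - dotv lam (constr y)) (fun=> 0)).
  exact: df.
move=> t v; rewrite constrD -scalemxAr; move: (constr x) => c.
by rewrite !dotvE dotv_mulmx trmxK; ring.
Qed.

Lemma grad_auglagE x lam :
  grad_auglag f A b alpha x lam = grad f x - A^T *m (lam - alpha *: constr x).
Proof.
pose q y := - dotv lam (constr y) + alpha / 2 * dotv (constr y) (constr y).
have lagE : (fun y => auglag f A b alpha y lam) = (fun y => f y + q y).
  by apply/funext => y; rewrite /auglag sqr_enorm addrA.
rewrite /grad_auglag lagE.
apply: (@grad_add_quadratic _ _ _ q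
  (fun v : 'cV[R]_n => alpha / 2 * dotv (A *m v) (A *m v))); first exact: df.
move=> t v; rewrite /q constrD -scalemxAr; move: (constr x) => c.
rewrite !dotvE (dotv_mulmx A^T) trmxK !dotvE.
by rewrite (dotvC (A *m v) c); field.
Qed.

(** After the multiplier update, the gradients of the Lagrangian and of the
    augmented Lagrangian coincide. *)
Lemma grad_lag_update x lam :
  grad_lag f A b x (lam - alpha *: constr x) = grad_auglag f A b alpha x lam.
Proof. by rewrite grad_lagE grad_auglagE. Qed.

Lemma residual_unconstrained (eta : R) x lam : 0 < eta ->
  residual f A b setT alpha eta x lam = - grad_auglag f A b alpha x lam.
Proof.
move=> eta0; rewrite /residual.
have projT (y : 'cV[R]_n) : Defs.proj setT y = y.
  rewrite /Defs.proj; case: xgetP => [z _ [_ /(_ y I)]|/(_ y)[]].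
    rewrite subrr {2}/enorm dotv0 sqrtr0 => yz.
    apply/esym/subr0_eq/dotv_eq0; rewrite -sqr_enorm.
    by rewrite (_ : enorm _ = 0) ?expr0n//; apply/eqP; rewrite eq_le yz enorm_ge0.
  by split => // w _; rewrite subrr {1}/enorm dotv0 sqrtr0 enorm_ge0.
by rewrite projT addrAC subrr add0r scalerN scalerA mulVf ?gt_eqF// scale1r.
Qed.

Let f_continuous : continuous f.
Proof. by move=> x; exact: differentiable_continuous. Qed.

Lemma constr_continuous k (g : 'cV[R]_k -> 'cV[R]_n) :
  continuous g -> continuous (fun w => constr (g w)).
Proof.
move=> cg w; apply: (@continuousB _ _ _ (fun w => A *m g w) (cst b)).
  exact: mulmx_continuous.
exact: cst_continuous.
Qed.

Definition xmin u : 'cV[R]_n := argmin (fun y => auglag f A b alpha y u).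

(** The gradient of the Moreau envelope at [u]. *)
Definition cmin u : 'cV[R]_m := constr (xmin u).

(** The proximal point of [u] for the negative dual function, which is also the
    multiplier that an exact iteration from [u] produces. *)
Definition prox u : 'cV[R]_m := u - alpha *: cmin u.

(** Strong convexity gives the quadratic growth that makes a minimizer exist,
    so that the junk value of [argmin] is excluded. *)
Lemma xmin_le u y : auglag f A b alpha (xmin u) u <= auglag f A b alpha y u.
Proof.
move: y; apply: argmin_le.
apply: (@coercive_min _ _ _ 0 (grad_auglag f A b alpha 0 u) mu _ mu0).
  pose q y := - dotv u (constr y) + alpha / 2 * dotv (constr y) (constr y).
  have lagE : (fun y => auglag f A b alpha y u) = (fun y => f y + q y).
    by apply/funext => z; rewrite /auglag sqr_enorm addrA.
  have cc : continuous constr by apply: (@constr_continuous n (fun y => y)) => y.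
  rewrite lagE => z; apply: (@continuousD _ _ _ f q); first exact: f_continuous.
  apply: (@continuousD _ _ _ (fun y => - dotv u (constr y))
      (fun y => alpha / 2 * dotv (constr y) (constr y))).
    apply: (@continuousN _ _ _ (fun y => dotv u (constr y))).
    have uc : continuous (fun _ : 'cV[R]_n => u) by exact: cst_continuous.
    exact: (dotv_continuous uc cc).
  apply: (@continuousM _ _ (cst (alpha / 2)) (fun y => dotv (constr y) (constr y))).
    exact: cst_continuous.
  exact: (dotv_continuous cc cc).
move=> z; rewrite subr0 grad_auglagE /auglag !sqr_enorm -/constr.
have := strongly_convex_tangent df Lf scf 0 z.
rewrite (_ : constr z = constr 0 + A *m z); last by rewrite -constrD add0r.
rewrite add0r; move: (constr 0) => c.
have := mulr_ge0 (ltW alpha0) (dotv_ge0 (A *m z)).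
rewrite !dotvE (dotv_mulmx A^T) trmxK !dotvE (dotvC (A *m z) c). lra.
Qed.

(** The gradient of the augmented Lagrangian vanishes at its minimizer: a step
    of length [t] against it would decrease the function by a multiple of [t],
    up to [t ^+ 2]. *)
Lemma grad_xmin u : grad f (xmin u) = A^T *m prox u.
Proof.
apply/subr0_eq; have [g gE] : exists g, g = grad f (xmin u) - A^T *m prox u.
  by eexists.
rewrite -gE; apply: dotv_eq0.
apply: (@le0_linear_quadratic _ _
  (L / 2 * dotv g g + alpha / 2 * dotv (A *m g) (A *m g))) => t _.
have := xmin_le u (xmin u - t *: g).
have := descent_lemma df Lf (xmin u) (- (t *: g)).
have -> : grad f (xmin u) = g + A^T *m prox u by rewrite gE subrK.
rewrite /auglag -/constr !sqr_enorm constrD mulmxN -scalemxAr -/(cmin u).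
rewrite /prox; move: (cmin u) => c.
rewrite !dotvE (dotv_mulmx A^T) trmxK !dotvE (dotvC (A *m g) c); nra.
Qed.

(** Completing the square in the strong convexity inequality at 0. *)
Lemma lag_lower_bound lam : has_lbound (range (fun x => lag f A b x lam)).
Proof.
pose g := grad f 0 - A^T *m lam.
exists (f 0 - dotv lam (constr 0) - dotv g g / (2 * mu)) => _ [x _ <-].
have := strongly_convex_tangent df Lf scf 0 x.
have := dotv_ge0 (mu *: x + g).
rewrite /lag -/constr add0r -[in X in _ -> _ -> _ <= X](add0r x) constrD add0r.
have -> : dotv lam (constr 0 + A *m x) = dotv lam (constr 0) + dotv (A^T *m lam) x.
  by rewrite dotvDr (dotv_mulmx A^T) trmxK.
have -> : dotv (grad f 0) x = dotv g x + dotv (A^T *m lam) x.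
  by rewrite -dotvDl /g subrK.
move: g => g; rewrite !dotvE (dotvC x g) => h1 h2.
have : dotv g g / (2 * mu) + dotv g x + mu / 2 * dotv x x =
   (mu * (mu * dotv x x + dotv g x) + (mu * dotv g x + dotv g g)) / (2 * mu).
  by field; rewrite gt_eqF.
have := divr_ge0 h1 (ltW (mulr_gt0 (ltr0n R 2) mu0)).
lra.
Qed.

Lemma negdual_ge x lam : - lag f A b x lam <= negdual f A b lam.
Proof. by rewrite lerN2; apply: ge_inf; [exact: lag_lower_bound|exists x]. Qed.

(** By [grad_xmin] the linear terms of the Lagrangian at [prox u] cancel the
    tangent of [f] at [xmin u]. *)
Lemma lag_prox_ge u x :
  lag f A b (xmin u) (prox u) + mu / 2 * dotv (x - xmin u) (x - xmin u)
  <= lag f A b x (prox u).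
Proof.
have := strongly_convex_tangent df Lf scf (xmin u) (x - xmin u).
rewrite [xmin u + _]addrC subrK grad_xmin (dotv_mulmx A^T) trmxK mulmxBr => h.
rewrite /lag /Defs.constr; move: h.
by rewrite !dotvDr !dotvNr; lra.
Qed.

Lemma negdual_prox u : negdual f A b (prox u) = - lag f A b (xmin u) (prox u).
Proof.
rewrite /negdual (@minvalE _ _ _ (xmin u))// => y.
apply: le_trans (lag_prox_ge u y); rewrite lerDl mulr_ge0 ?dotv_ge0//.
by rewrite divr_ge0 ?(ltW mu0).
Qed.

(** Positivity of the smallest eigenvalue rules out a space with a single
    point, on which [L] could be negative. *)
Lemma lipschitz_constant_ge0 : 0 <= L.
Proof.
have [v Av0] := lambda_min_gram_gt0_neq0 sigma0.
have := Lf (A^T *m v) 0; rewrite subr0 => /(le_trans (enorm_ge0 _)).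
rewrite pmulr_lge0// lt_neqAle enorm_ge0 andbT.
apply: contra_neq Av0 => e0; apply: dotv_eq0.
by rewrite -sqr_enorm -e0 expr0n.
Qed.

Let muL0 : 0 < mu + L.
Proof. by rewrite ltr_pwDl// lipschitz_constant_ge0. Qed.

Definition mu_q := lambda_min (A *m A^T) / (mu + L).

Lemma mu_q_gt0 : 0 < mu_q. Proof. exact: divr_gt0. Qed.

(** The dual value at [lam] is tested with the Lagrangian at the gradient-like
    step [A^T *m (lam - prox u) / (mu + L)] from [xmin u]. *)
Lemma negdual_strongly_convex u lam :
  negdual f A b (prox u) + dotv (cmin u) (lam - prox u)
    + mu_q / 2 * dotv (lam - prox u) (lam - prox u) <= negdual f A b lam.
Proof.
have [e eE] : exists e, e = lam - prox u by eexists.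
have -> : lam = prox u + e by rewrite eE addrC subrK.
rewrite [prox u + e]addrC addrK; set k := (mu + L)^-1.
have k0 : 0 < k by rewrite invr_gt0.
have kL : k * L <= 1 by rewrite mulrC ler_pdivrMr// mul1r lerDr ltW.
(* [k * L <= 1] keeps half of the first-order gain [k * dotv z z]. *)
have := negdual_ge (xmin u + k *: (A^T *m e)) (e + prox u).
rewrite negdual_prox /lag -/constr constrD -/(cmin u) -scalemxAr mulmxA.
have := descent_lemma df Lf (xmin u) (k *: (A^T *m e)).
rewrite grad_xmin [dotv (A^T *m prox u) _](dotv_mulmx A^T) trmxK.
have := lambda_min_gram A e; rewrite -scalemxAr mulmxA.
have := dotv_gram A e; have := dotv_ge0 (A^T *m e).
rewrite /mu_q -/k; move: (A *m A^T *m e) (lambda_min _) (f (_ + _)) => w s fy.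
move: (A^T *m e) (cmin u) (prox u) => z c p.
rewrite !dotvE => z0 ew es fle qge; rewrite (dotvC c e).
apply: le_trans qge.
have h1 : k * (s * dotv e e) <= k * dotv z z by rewrite ler_pM2l.
have h2 : k * L * (k * dotv z z) <= 1 * (k * dotv z z).
  by rewrite ler_wpM2r// mulr_ge0// ltW.
rewrite ew; lra.
Qed.

Let q_alpha := moreau_negdual f A b alpha.
Definition mu_moreau := mu_q / (mu_q * alpha + 1).

Let mu_qa0 : 0 < mu_q * alpha + 1.
Proof. by rewrite ltr_wpDl// mulr_ge0 ?ltW ?mu_q_gt0. Qed.

Lemma mu_moreau_gt0 : 0 < mu_moreau.
Proof. by rewrite divr_gt0 ?mu_q_gt0. Qed.

Lemma alpha_mu_moreau_lt1 : alpha * mu_moreau < 1.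
Proof. by rewrite mulrA ltr_pdivrMr// mul1r mulrC ltrDl. Qed.

(** The two quadratic terms, with moduli [mu_q] and [alpha^-1], combine into
    their parallel sum [mu_moreau]. *)
Lemma moreau_lower_bound u v lam :
  negdual f A b (prox u) + alpha / 2 * dotv (cmin u) (cmin u)
    + dotv (cmin u) (v - u) + mu_moreau / 2 * dotv (v - u) (v - u)
  <= negdual f A b lam + (2 * alpha)^-1 * enorm (lam - v) ^+ 2.
Proof.
have := negdual_strongly_convex u lam.
rewrite sqr_enorm.
have [e eE] : exists e, e = lam - prox u by eexists.
(* This [w] completes the square in [lam - v] and the gradient [cmin u]. *)
have [w wE] : exists w, w = v - lam - alpha *: cmin u by eexists.
have -> : v - u = e + w.
  by rewrite eE wE /prox; apply/colP => i; rewrite !mxE; ring.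
have -> : lam - v = - (w + alpha *: cmin u).
  by rewrite wE; apply/colP => i; rewrite !mxE; ring.
rewrite -eE; move: (cmin u) (negdual _ _ _ _) (negdual _ _ _ lam) => c q1 q2.
have parallel : mu_moreau / 2 * dotv (e + w) (e + w) <=
    mu_q / 2 * dotv e e + (2 * alpha)^-1 * dotv w w.
  have := dotv_ge0 ((mu_q * alpha) *: e - w).
  move=> h; rewrite -subr_ge0.
  suff -> : mu_q / 2 * dotv e e + (2 * alpha)^-1 * dotv w w -
      mu_moreau / 2 * dotv (e + w) (e + w) =
    dotv ((mu_q * alpha) *: e - w) ((mu_q * alpha) *: e - w)
      / (2 * alpha * (mu_q * alpha + 1)).
    by rewrite divr_ge0// ltW// !mulr_gt0.
  rewrite /mu_moreau !dotvE (dotvC w e); field.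
  by rewrite !gt_eqF.
move=> h; apply: (@le_trans _ _ (q1 + dotv c e + mu_q / 2 * dotv e e +
   (2 * alpha)^-1 * dotv (w + alpha *: c) (w + alpha *: c))); last first.
  by rewrite dotvNl dotvNr opprK lerD2r.
have -> : (2 * alpha)^-1 * dotv (w + alpha *: c) (w + alpha *: c) =
    (2 * alpha)^-1 * dotv w w + dotv c w + alpha / 2 * dotv c c.
  by rewrite !dotvE (dotvC w c); field; rewrite gt_eqF.
rewrite (dotvDr e w c); lra.
Qed.

Let prox_obj u : negdual f A b (prox u) + (2 * alpha)^-1 * enorm (prox u - u) ^+ 2
  = negdual f A b (prox u) + alpha / 2 * dotv (cmin u) (cmin u).
Proof.
have -> : prox u - u = - (alpha *: cmin u) by rewrite /prox addrAC subrr add0r.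
by rewrite sqr_enorm !dotvE; field; rewrite gt_eqF.
Qed.

Let prox_min u lam :
  negdual f A b (prox u) + (2 * alpha)^-1 * enorm (prox u - u) ^+ 2
  <= negdual f A b lam + (2 * alpha)^-1 * enorm (lam - u) ^+ 2.
Proof.
rewrite prox_obj; have := moreau_lower_bound u u lam.
by rewrite subrr !dotv0 mulr0 !addr0.
Qed.

Lemma moreauE u :
  q_alpha u = negdual f A b (prox u) + alpha / 2 * dotv (cmin u) (cmin u).
Proof. by rewrite -prox_obj; exact: minvalE (prox_min u). Qed.

(** The bound of [moreau_lower_bound] at the proximal point of [v]. *)
Lemma moreau_tangent u v : q_alpha u + dotv (cmin u) (v - u)
  + mu_moreau / 2 * dotv (v - u) (v - u) <= q_alpha v.
Proof. by rewrite !moreauE -[leRHS]prox_obj moreau_lower_bound. Qed.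

(** The proximal point of [u] is a competitor in the minimum that defines the
    envelope at [v]. *)
Lemma moreau_smooth u v : q_alpha v <= q_alpha u + dotv (cmin u) (v - u)
  + (2 * alpha)^-1 * dotv (v - u) (v - u).
Proof.
rewrite (moreauE v) -prox_obj; apply: le_trans (prox_min v (prox u)) _.
have -> : prox u - v = - (alpha *: cmin u + (v - u)).
  by rewrite /prox; apply/colP => i; rewrite !mxE; ring.
rewrite moreauE sqr_enorm; move: (v - u) (cmin u) => w c.
rewrite le_eqVlt; apply/orP; left; apply/eqP.
by rewrite !dotvE (dotvC w c); field; rewrite gt_eqF.
Qed.

(** Minimizing [moreau_tangent] over [v] gives this gradient domination
    inequality. *)
Lemma moreau_gradient_dominated u v :
  2 * mu_moreau * (q_alpha u - q_alpha v) <= dotv (cmin u) (cmin u).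
Proof.
have h := ler_wpM2l (ltW mu_moreau_gt0) (moreau_tangent u v).
have := dotv_ge0 (cmin u + mu_moreau *: (v - u)).
move: h; move: (v - u) (cmin u) => w c.
by rewrite !dotvE (dotvC w c); lra.
Qed.

(** A dual step with the exact constraint violation decreases the envelope by
    [alpha / 2 * dotv (cmin u) (cmin u)]; with the violation at an inexact
    [x] the error is paid with the same factor. *)
Lemma moreau_dual_step u x :
  q_alpha (u - alpha *: constr x) + alpha / 2 * dotv (cmin u) (cmin u)
  <= q_alpha u + alpha / 2 * dotv (constr x - cmin u) (constr x - cmin u).
Proof.
have := moreau_smooth u (u - alpha *: constr x).
rewrite [u - _ - u]addrAC subrr add0r; move: (constr x) (cmin u) => c d.
have -> : (2 * alpha)^-1 * dotv (- (alpha *: c)) (- (alpha *: c)) =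
    alpha / 2 * dotv c c.
  by rewrite !dotvE; field; rewrite gt_eqF.
rewrite !dotvE (dotvC d c); lra.
Qed.

(** The penalty term contributes a nonnegative multiple of the squared norm of
    [A *m (x - xmin u)] to the strong monotonicity of the gradient of [f]. *)
Lemma grad_auglag_monotone u x :
  mu * dotv (x - xmin u) (x - xmin u) <=
  dotv (grad_auglag f A b alpha x u) (x - xmin u).
Proof.
apply: le_trans (grad_strongly_monotone df Lf scf x (xmin u)) _.
have [g gE] : exists g, g = grad f x - grad f (xmin u) by eexists.
have -> : grad_auglag f A b alpha x u = g + alpha *: (A^T *m (A *m (x - xmin u))).
  rewrite grad_auglagE gE grad_xmin -constrB -/(cmin u) /prox.
  rewrite !(mulmxBr A^T u) (mulmxBr A^T (constr x)) -!scalemxAr.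
  move: (A^T *m _) (A^T *m _) (A^T *m _) => p q r.
  by apply/colP => i; rewrite !mxE; ring.
rewrite -gE dotvDl lerDl dotvZl (dotv_mulmx A^T) trmxK.
by rewrite mulr_ge0 ?dotv_ge0// ltW.
Qed.

Lemma primal_error u x : mu * enorm (x - xmin u) <=
  enorm (grad_auglag f A b alpha x u).
Proof.
have := le_trans (grad_auglag_monotone u x) (dotv_le_enorm _ _).
have := enorm_ge0 (x - xmin u); rewrite le_eqVlt => /predU1P[<-|h0].
  by rewrite !mulr0 enorm_ge0.
by rewrite -sqr_enorm expr2 mulrA ler_pM2r.
Qed.

Lemma constr_error u x : dotv (constr x - cmin u) (constr x - cmin u) <=
  (mxnorm2 A / mu) ^+ 2 * enorm (grad_auglag f A b alpha x u) ^+ 2.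
Proof.
rewrite /cmin constrB -sqr_enorm -exprMn ler_pXn2r ?nnegrE ?enorm_ge0//.
  apply: le_trans (enorm_mulmx_le _ _) _; rewrite -mulrA ler_wpM2l ?mxnorm2_ge0//.
  by rewrite ler_pdivlMl// primal_error.
by rewrite mulr_ge0 ?enorm_ge0 ?divr_ge0 ?mxnorm2_ge0 ?(ltW mu0).
Qed.

(** At [xmin u] the augmented Lagrangian for [v] has gradient
    [A^T *m (u - v)]. *)
Lemma xmin_lipschitz u v :
  enorm (xmin u - xmin v) <= mxnorm2 A^T / mu * enorm (u - v).
Proof.
have := primal_error v (xmin u).
have -> : grad_auglag f A b alpha (xmin u) v = A^T *m (u - v).
  rewrite grad_auglagE grad_xmin -/(cmin u) /prox !mulmxBr.
  move: (A^T *m _) (A^T *m _) (A^T *m _) => p q r.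
  by apply/colP => i; rewrite !mxE; ring.
move=> /le_trans/(_ (enorm_mulmx_le _ _)).
by rewrite mulrC -ler_pdivlMr// mulrAC.
Qed.

Lemma xmin_continuous : continuous xmin.
Proof. exact: lipschitz_continuous xmin_lipschitz. Qed.

Lemma cmin_continuous : continuous cmin.
Proof. exact: constr_continuous xmin_continuous. Qed.

(** The envelope is minus the minimum of the augmented Lagrangian, hence an
    explicit continuous function of [u] and [xmin u]. *)
Lemma moreau_continuous : continuous q_alpha.
Proof.
have -> : q_alpha = (fun u => - f (xmin u) +
    (dotv u (cmin u) - alpha / 2 * dotv (cmin u) (cmin u))).
  apply/funext => u; rewrite moreauE negdual_prox /lag -/constr -/(cmin u).
  by rewrite /prox; move: (cmin u) => c; rewrite !dotvE; field.
have idc : continuous (fun u : 'cV[R]_m => u) by move=> u.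
have cc := cmin_continuous.
move=> u; apply: (@continuousD _ _ _ (fun u => - f (xmin u))
  (fun u => dotv u (cmin u) - alpha / 2 * dotv (cmin u) (cmin u))).
  apply: (@continuousN _ _ _ (fun u => f (xmin u))).
  apply: (@continuous_comp _ _ _ xmin f); first exact: xmin_continuous.
  exact: f_continuous.
apply: (@continuousB _ _ _ (fun u => dotv u (cmin u))
  (fun u => alpha / 2 * dotv (cmin u) (cmin u))).
  exact: (dotv_continuous idc cc).
apply: (@continuousM _ _ (cst (alpha / 2)) (fun u => dotv (cmin u) (cmin u))).
  exact: cst_continuous.
exact: (dotv_continuous cc cc).
Qed.

Lemma moreau_argmin_le v : q_alpha (argmin q_alpha) <= q_alpha v.
Proof.
apply: argmin_le.
apply: (@coercive_min _ _ _ 0 (cmin 0) _ moreau_continuous mu_moreau_gt0) => y.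
by rewrite sqr_enorm moreau_tangent.
Qed.

(** The decrease achieved by an exact dual step cannot exceed the gap. *)
Lemma cmin_le_gap u :
  alpha / 2 * dotv (cmin u) (cmin u) <= q_alpha u - q_alpha (argmin q_alpha).
Proof.
have := moreau_dual_step u (xmin u); rewrite -/(cmin u) subrr dotv0 mulr0 addr0.
by have := moreau_argmin_le (u - alpha *: cmin u); lra.
Qed.

End augmented_lagrangian.

(** * Random vectors and means of nonnegative variables *)

Section random_vectors.
Variables (R : realType) (d : measure_display) (Omega : measurableType d).

Definition coord_measurable n (X : Omega -> 'cV[R]_n) : Prop :=
  forall i, measurable_fun [set: Omega] (fun w => X w i 0).

(** An open set of vectors is the union of the countably many rational boxes
    that it contains, and the preimage of a box is a finite intersection. *)
Lemma measurable_continuous_comp n (X : Omega -> 'cV[R]_n) (g : 'cV[R]_n -> R) :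
  coord_measurable X -> continuous g -> measurable_fun [set: Omega] (g \o X).
Proof.
move=> Xm cg.
apply: (measurability _ (RGenOInfty.measurableE R)) => _ [_ [r ->] <-].
rewrite setTI; pose U := g @^-1` [set` `]r, +oo[].
have Uo : open U by move/continuousP: cg; apply; exact: interval_open.
pose box (c : 'cV[rat]_n * rat) :=
  [set v : 'cV[R]_n | forall i, `|v i 0 - ratr (c.1 i 0)| < ratr c.2].
pose F c := [set w | box c `<=` U /\ box c (X w)].
rewrite (_ : _ @^-1` _ = \bigcup_c F c); last first.
  apply/seteqP; split => [w /= Uw|w [c _ [cU /cU]]//].
  have /nbhs_ballP[e /= e0 eU] := open_nbhs_nbhs (conj Uo Uw).
  have e20 : 0 < e / 2 by rewrite divr_gt0.
  have [q] := rat_in_itvoo e20; rewrite in_itv/= => /andP[q0 qe].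
  have near_rat i : exists s : rat, `|X w i 0 - ratr s| < ratr q.
    have xq : X w i 0 < X w i 0 + ratr q by rewrite ltrDl.
    have [s] := rat_in_itvoo xq; rewrite in_itv/= => /andP[xs sx].
    by exists s; rewrite ltr_norml; lra.
  have [c cX] := fin_all_exists near_rat.
  have boxX : box (\col_i c i, q) (X w) by move=> i; rewrite /= mxE; exact: cX.
  exists (\col_i c i, q) => //; split => // v vbox; apply: eU => /=.
  split=> // i j; rewrite (ord1 j) -ball_normE /=.
  have := boxX i; have := vbox i; rewrite /= !ltr_norml; lra.
apply: countable_bigcupT_measurable => [|c]; first exact: countableP.
have [cU|cU] := pselect (box c `<=` U); last first.
  by rewrite (_ : F c = set0)// -subset0 => w [].
rewrite (_ : F c = \bigcap_(i in [set: 'I_n])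
    [set w | `|X w i 0 - ratr (c.1 i 0)| < ratr c.2]); last first.
  by apply/seteqP; split => [w [_ h] i _|w h]; [exact: h|split => // i; exact: h].
apply: fin_bigcap_measurable => // i _.
rewrite -[X in measurable X]setTI.
rewrite (_ : [set w | _] = (fun w => X w i 0) @^-1`
    [set` `]ratr (c.1 i 0) - ratr c.2, ratr (c.1 i 0) + ratr c.2[]); last first.
  by apply/seteqP; split => w /=; rewrite in_itv/= ltr_norml; lra.
by apply: Xm => //; exact: measurable_itv.
Qed.

Lemma coord_measurable_continuous n m (X : Omega -> 'cV[R]_n)
    (g : 'cV[R]_n -> 'cV[R]_m) :
  coord_measurable X -> continuous g -> coord_measurable (g \o X).
Proof.
move=> Xm cg i; apply: (measurable_continuous_comp (g := fun v => g v i 0) Xm).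
exact: continuous_coord.
Qed.

Lemma coord_measurableB n (X Y : Omega -> 'cV[R]_n) :
  coord_measurable X -> coord_measurable Y ->
  coord_measurable (fun w => X w - Y w).
Proof.
move=> Xm Ym i; rewrite (_ : (fun w => _) = (fun w => X w i 0 - Y w i 0)).
  exact: measurable_funB.
by apply/funext => w; rewrite !mxE.
Qed.

Lemma measurable_dotvv n (X : Omega -> 'cV[R]_n) :
  coord_measurable X -> measurable_fun [set: Omega] (fun w => dotv (X w) (X w)).
Proof.
move=> Xm; apply: (measurable_continuous_comp (g := fun v => dotv v v) Xm).
by apply: dotv_continuous => v.
Qed.

End random_vectors.

Section means.
Variables (R : realType) (d : measure_display) (Omega : measurableType d).
Variable P : probability Omega R.
Implicit Types g h : Omega -> R.

(** Nonnegativity makes the integral meaningful without integrability, and the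
    mean [e] is then a real number. *)
Record has_mean g (e : R) : Prop := HasMean {
  mean_measurable : measurable_fun [set: Omega] g ;
  mean_nonneg : forall w, 0 <= g w ;
  meanE : (\int[P]_w (g w)%:E = e%:E)%E
}.

Lemma has_mean_cst (c : R) : 0 <= c -> has_mean (fun=> c) c.
Proof.
move=> c0; split => //.
by rewrite integral_cst//= probability_setT mule1.
Qed.

Lemma has_mean_lin g h (e e' p q : R) : has_mean g e -> has_mean h e' ->
  0 <= p -> 0 <= q -> has_mean (fun w => p * g w + q * h w) (p * e + q * e').
Proof.
move=> [gm g0 ge] [hm h0 he] p0 q0.
have pgm : measurable_fun setT (fun w => p * g w) by exact: measurable_funM.
have qhm : measurable_fun setT (fun w => q * h w) by exact: measurable_funM.
split; first exact: measurable_funD.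
  by move=> w; rewrite addr_ge0 ?mulr_ge0.
have intZ (k : R) (r : Omega -> R) : 0 <= k -> measurable_fun setT r ->
    (forall w, 0 <= r w) ->
    (\int[P]_w (k * r w)%:E = k%:E * \int[P]_w (r w)%:E)%E.
  move=> k0 rm r0; under eq_integral do rewrite EFinM.
  rewrite ge0_integralZl_EFin//; last exact/measurable_EFinP.
  by move=> w _; rewrite lee_fin.
under eq_integral do rewrite EFinD.
rewrite ge0_integralD//=.
- by rewrite !intZ// ge he.
- by move=> w _; rewrite lee_fin mulr_ge0.
- exact/measurable_EFinP.
- by move=> w _; rewrite lee_fin mulr_ge0.
- exact/measurable_EFinP.
Qed.

Lemma has_mean_ge0 g e : has_mean g e -> 0 <= e.
Proof.
by move=> [_ g0 ge]; rewrite -lee_fin -ge integral_ge0// => w _; rewrite lee_fin.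
Qed.

Lemma has_mean_le g h e e' : has_mean g e -> has_mean h e' ->
  (forall w, g w <= h w) -> e <= e'.
Proof.
move=> [gm g0 ge] [hm h0 he] gh; rewrite -lee_fin -ge -he.
by apply: ge0_le_integral => //=; [move=> w _; rewrite lee_fin|exact/measurable_EFinP..|
  move=> w _; rewrite lee_fin].
Qed.

Lemma has_mean_of_le g e : measurable_fun setT g -> (forall w, 0 <= g w) ->
  (\int[P]_w (g w)%:E <= e%:E)%E -> exists2 e', e' <= e & has_mean g e'.
Proof.
move=> gm g0 ge.
have i0 : (0 <= \int[P]_w (g w)%:E)%E.
  by apply: integral_ge0 => w _; rewrite lee_fin.
have fin : (\int[P]_w (g w)%:E)%E \is a fin_num.
  by rewrite ge0_fin_numE// (le_lt_trans ge)// ltry.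
exists (fine (\int[P]_w (g w)%:E)%E); first by rewrite -lee_fin fineK.
by split; rewrite ?fineK.
Qed.

Lemma has_mean_dom g h e : measurable_fun setT g -> (forall w, 0 <= g w) ->
  (forall w, g w <= h w) -> has_mean h e -> exists2 e', e' <= e & has_mean g e'.
Proof.
move=> gm g0 gh [hm h0 he]; apply: has_mean_of_le => //; rewrite -he.
by apply: ge0_le_integral => //=; [move=> w _; rewrite lee_fin|exact/measurable_EFinP..|
  move=> w _; rewrite lee_fin].
Qed.

(** The conditional expectation has the same integral as [Z] over the whole
    space, so that an almost sure bound on it is a bound on the mean of [Z]. *)
Lemma has_mean_condexp (G : set (set Omega)) Z Y h e :
  G setT -> G `<=` measurable -> cond_expectation_nneg P G Z Y ->
  measurable_fun setT Z -> (forall w, 0 <= Z w) ->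
  has_mean h e -> {ae P, forall w, (Y w <= (h w)%:E)%E} ->
  exists2 e', e' <= e & has_mean Z e'.
Proof.
move=> GT Gm [Y0 Ym YZ] Zm Z0 [hm h0 he] Yh.
apply: has_mean_of_le => //; rewrite -YZ// -he.
apply: ae_ge0_le_integral => //=.
- by move=> _ B mB; rewrite setTI; apply: Gm; exact: Ym.
- by move=> w _; rewrite lee_fin.
- exact/measurable_EFinP.
- by apply: filterS Yh => w Yw _.
Qed.

End means.

(** * Linear convergence *)

(** Here [D] and [D'] are the mean gaps before and after an iteration, [C] is the
    mean squared exact constraint violation and [e] the mean squared error on
    it.  Half of the contraction margin [alpha * mua * (1 - th2)] is given up to
    absorb the noise [tau]. *)
Lemma gap_contraction (R : realType) (alpha mua th2 tau B D D' C e : R) :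
  0 < alpha -> 0 < mua -> alpha * mua < 1 -> 0 <= th2 < 1 -> 0 <= B -> 0 <= C ->
  D <= B -> tau <= mua * (1 - th2) * B ->
  2 * mua * D <= C -> e <= th2 / 4 * C + tau / 4 ->
  D' + alpha / 2 * C <= D + alpha / 2 * e ->
  D' <= (1 - alpha * mua * (1 - th2) / 2) * B.
Proof.
move=> a0 m0 am1 /andP[t0 t1] B0 C0 DB tauB DC ee step.
have s0 : 0 < 1 - th2 by rewrite subr_gt0.
have h1 : alpha / 2 * e <= alpha / 2 * (th2 / 4 * C + tau / 4).
  by rewrite ler_wpM2l// divr_ge0// ltW.
have h2 : alpha * (1 - th2) / 2 * (2 * mua * D) <= alpha * (1 - th2) / 2 * C.
  by rewrite ler_wpM2l// divr_ge0// mulr_ge0// ltW.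
have h3 : alpha / 2 * tau <= alpha / 2 * (mua * (1 - th2) * B).
  by rewrite ler_wpM2l// divr_ge0// ltW.
have h4 : 0 <= alpha * th2 * C by rewrite !mulr_ge0// ltW.
have r0 : 0 <= 1 - alpha * mua * (1 - th2).
  rewrite subr_ge0 mulr_ile1 ?(ltW am1) ?(ltW s0)// ?mulr_ge0 ?(ltW a0) ?(ltW m0)//.
  by rewrite gerBl.
have h5 := ler_wpM2l r0 DB.
have h6 : 0 <= alpha * mua * (1 - th2) * B by rewrite !mulr_ge0// ltW.
lra.
Qed.

Lemma history_measurable (d dXi : measure_display) (Omega : measurableType d)
    (Xi : nat -> measurableType dXi) (xi : forall k, Omega -> Xi k) k :
  (forall k, measurable_fun setT (xi k)) -> history xi k `<=` measurable.
Proof.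
move=> xim; apply: smallest_sub; first exact: sigma_algebra_measurable.
by move=> _ [j _ [B mB <-]]; exact: xim.
Qed.

Lemma history_setT (d dXi : measure_display) (Omega : measurableType d)
    (Xi : nat -> measurableType dXi) (xi : forall k, Omega -> Xi k) k :
  history xi k setT.
Proof.
have [h0 hC _] := smallest_sigma_algebra [set: Omega]
  (\bigcup_(j in [set j | (j < k)%N]) preimage_set_system setT (xi j) measurable).
by have := hC _ h0; rewrite setD0.
Qed.

Section method_step.
Variables (R : realType) (m n : nat).
Variables (A : 'M[R]_(m, n)) (b : 'cV[R]_m) (f : 'cV[R]_n -> R) (L mu : R).
Variables (d dXi : measure_display) (Omega : measurableType d).
Variables (P : probability Omega R) (Xi : nat -> measurableType dXi).
Variables (xi : forall k, Omega -> Xi k).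
Variables (solver : forall k, 'cV[R]_n -> 'cV[R]_m -> Xi k -> 'cV[R]_n).
Variables (xinit : 'cV[R]_n) (lam0 : 'cV[R]_m) (alpha eta : R).
Variables (x : nat -> Omega -> 'cV[R]_n) (lam : nat -> Omega -> 'cV[R]_m).
Variables (EkR2 : nat -> Omega -> \bar R) (delta ttau : R) (k : nat).

Let q_alpha := moreau_negdual f A b alpha.
Let gap u := q_alpha u - q_alpha (argmin q_alpha).
Let cmin := cmin f A b alpha.

Hypotheses (sigma0 : 0 < lambda_min (A *m A^T)) (f1 : C1 f).
Hypotheses (Lf : lipschitz_grad L f) (mu0 : 0 < mu).
Hypotheses (scf : strongly_convex mu f) (alpha0 : 0 < alpha) (eta0 : 0 < eta).
Hypothesis alm : inexact_alm A b alpha xi solver xinit lam0 x lam.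
Hypothesis condexpR : cond_expectation_nneg P (history xi k)
  (fun w => enorm (residual f A b setT alpha eta (x k w) (lam k w)) ^+ 2) (EkR2 k).
Hypothesis delta0 : 0 <= delta.
Hypothesis ttau0 : 0 <= ttau.
Hypothesis inexact : {ae P, forall w, (EkR2 k w <=
  (delta * enorm (cmin (lam k w)) ^+ 2 + ttau)%:E)%E}.

Let df := f1.1.

Lemma primal_coord_measurable j : coord_measurable (x j).
Proof.
move=> i _ B mB; rewrite setTI.
apply: (history_measurable (alm_randomness alm)).
exact: alm_primal_measurable alm j i B mB.
Qed.

Lemma constr_continuous_id : continuous (constr A b).
Proof. by apply: (@constr_continuous _ _ _ A b n (fun y => y)) => y. Qed.

Lemma dual_coord_measurable j : coord_measurable (lam j).
Proof.
elim: j => [|j IH].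
  have -> : lam 0%N = cst lam0 by apply/funext => w; rewrite (alm_lam0 alm).
  by move=> i; exact: measurable_cst.
have -> : lam j.+1 = (fun w => lam j w - (alpha *: constr A b (x j w))).
  by apply/funext => w; rewrite (alm_dual alm).
apply: (coord_measurableB IH).
apply: (@coord_measurable_continuous _ _ _ _ _ (constr A b \o x j)); last first.
  exact: (@scaler_continuous _ _ alpha).
exact: coord_measurable_continuous (primal_coord_measurable j) constr_continuous_id.
Qed.

Lemma gap_ge0 u : 0 <= gap u.
Proof. by rewrite subr_ge0 (moreau_argmin_le b df Lf mu0 scf alpha0 sigma0). Qed.

Lemma gap_measurable j : measurable_fun setT (gap \o lam j).
Proof.
apply: measurable_funB; last exact: measurable_cst.
apply: measurable_continuous_comp (dual_coord_measurable j) _.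
exact: moreau_continuous df Lf mu0 scf alpha0 sigma0.
Qed.

(** The pointwise inequalities of one outer iteration, averaged; [C] and [e] are
    the means of the squared exact constraint violation and of the squared error
    on it.  Finiteness of every mean follows from that of the mean gap [D], which
    is what allows subtraction in the recursion. *)
Lemma expected_step D : has_mean P (gap \o lam k) D ->
  exists D' C e G c2,
  [/\ has_mean P (gap \o lam k.+1) D',
      has_mean P (fun w => enorm (constr A b (x k w)) ^+ 2) c2,
      has_mean P (fun w => enorm (grad_lag f A b (x k w) (lam k.+1 w)) ^+ 2) G &
  [/\ 0 <= C, 2 * mu_moreau A L mu alpha * D <= C, alpha / 2 * C <= D,
      D' + alpha / 2 * C <= D + alpha / 2 * e &
  [/\ G <= delta * C + ttau, e <= (mxnorm2 A / mu) ^+ 2 * G &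
      c2 <= 2 * C + 2 * e]]].
Proof.
move=> gapD.
pose sq w := dotv (cmin (lam k w)) (cmin (lam k w)).
pose er w := dotv (constr A b (x k w) - cmin (lam k w))
  (constr A b (x k w) - cmin (lam k w)).
pose gr w := enorm (grad_lag f A b (x k w) (lam k.+1 w)) ^+ 2.
have gradE w : grad_lag f A b (x k w) (lam k.+1 w) =
    grad_auglag f A b alpha (x k w) (lam k w).
  by rewrite (alm_dual alm) (grad_lag_update _ _ _ df).
have cm : coord_measurable (cmin \o lam k).
  apply: coord_measurable_continuous (dual_coord_measurable k) _.
  exact: cmin_continuous df Lf mu0 scf alpha0.
have cx : coord_measurable (constr A b \o x k).
  apply: coord_measurable_continuous (primal_coord_measurable k) _.
  exact: constr_continuous_id.
have grm : measurable_fun setT gr.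
  rewrite (_ : gr = fun w => dotv (grad f (x k w) - (fun u => A^T *m u) (lam k.+1 w))
      (grad f (x k w) - (fun u => A^T *m u) (lam k.+1 w))); last first.
    by apply/funext => w; rewrite /gr sqr_enorm (grad_lagE _ _ df).
  apply/measurable_dotvv/coord_measurableB.
    exact: coord_measurable_continuous (primal_coord_measurable k) f1.2.
  apply: coord_measurable_continuous (dual_coord_measurable k.+1) _.
  by apply: (@mulmx_continuous _ _ _ _ A^T (fun u => u)) => u.
have gr0 w : 0 <= gr w by exact: sqr_ge0.
have resE w : enorm (residual f A b setT alpha eta (x k w) (lam k w)) ^+ 2 = gr w.
  by rewrite residual_unconstrained// /gr gradE !sqr_enorm dotvNl dotvNr opprK.
have [C _ meanC] : exists2 C, C <= 2 / alpha * D + 0 * D & has_mean P sq C.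
  have a20 : 0 <= 2 / alpha by rewrite divr_ge0// ltW.
  apply: has_mean_dom (has_mean_lin gapD gapD a20 (lexx 0)).
  - exact: measurable_dotvv cm.
  - by move=> w; exact: dotv_ge0.
  - move=> w; rewrite mul0r addr0 -ler_pdivrMl ?divr_gt0// invf_div.
    exact: (cmin_le_gap b df Lf mu0 scf alpha0 sigma0).
have condgr : cond_expectation_nneg P (history xi k) gr (EkR2 k).
  by move: condexpR; congr cond_expectation_nneg; apply/funext => w; rewrite resE.
have histT : history xi k setT by exact: history_setT.
have histm : history xi k `<=` measurable.
  exact/history_measurable/(alm_randomness alm).
have [G GC meanG] : exists2 G, G <= delta * C + ttau * 1 & has_mean P gr G.
  apply: (has_mean_condexp histT histm condgr grm gr0
    (has_mean_lin meanC (has_mean_cst P ler01) delta0 ttau0)).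
  by apply: filterS inexact => w; rewrite sqr_enorm mulr1.
pose kappa := (mxnorm2 A / mu) ^+ 2.
have [e eG meane] : exists2 e, e <= kappa * G + 0 * G & has_mean P er e.
  apply: has_mean_dom (has_mean_lin meanG meanG (sqr_ge0 _) (lexx 0)).
  - exact/measurable_dotvv/coord_measurableB.
  - by move=> w; exact: dotv_ge0.
  - move=> w; rewrite mul0r addr0 /gr gradE.
    exact: (constr_error _ _ df Lf mu0 scf alpha0).
have a20 : 0 <= alpha / 2 by rewrite divr_ge0// ltW.
have step w : gap (lam k.+1 w) + alpha / 2 * sq w
    <= gap (lam k w) + alpha / 2 * er w.
  rewrite (alm_dual alm) /gap.
  have := moreau_dual_step b df Lf mu0 scf alpha0 sigma0 (lam k w) (x k w).
  by rewrite -/q_alpha -/cmin -/(sq w) -/(er w); lra.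
have meanR := has_mean_lin gapD meane ler01 a20.
have [D' _ meanD'] : exists2 D', D' <= 1 * D + alpha / 2 * e
    & has_mean P (gap \o lam k.+1) D'.
  apply: has_mean_dom meanR.
  - exact: gap_measurable.
  - by move=> w; exact: gap_ge0.
  - move=> w /=; apply: le_trans (le_trans (step w) _); last by rewrite mul1r.
    by rewrite lerDl mulr_ge0// dotv_ge0.
have [c2 c2le meanc2] : exists2 c2, c2 <= 2 * C + 2 * e
    & has_mean P (fun w => enorm (constr A b (x k w)) ^+ 2) c2.
  apply: has_mean_dom (has_mean_lin meanC meane (ler0n _ 2) (ler0n _ 2)).
  - rewrite (_ : (fun w => _) = (fun w =>
        dotv ((constr A b \o x k) w) ((constr A b \o x k) w))).
      exact: measurable_dotvv.
    by apply/funext => w; rewrite sqr_enorm.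
  - by move=> w; exact: sqr_ge0.
  - by move=> w; rewrite sqr_enorm; exact: dotv_addN_le.
exists D', C, e, G, c2; split => //; split.
- exact: has_mean_ge0 meanC.
- have m0 : 0 <= 2 * mu_moreau A L mu alpha.
    by rewrite mulr_ge0// ltW// (mu_moreau_gt0 Lf mu0 alpha0 sigma0).
  rewrite -[leLHS]addr0 -(mul0r D).
  apply: has_mean_le (has_mean_lin gapD gapD m0 (lexx 0)) meanC _ => w.
  rewrite mul0r addr0.
  exact: (moreau_gradient_dominated b df Lf mu0 scf alpha0 sigma0).
- rewrite -[leLHS]addr0 -(mul0r C).
  apply: has_mean_le (has_mean_lin meanC meanC a20 (lexx 0)) gapD _ => w.
  rewrite mul0r addr0.
  exact: (cmin_le_gap b df Lf mu0 scf alpha0 sigma0).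
- rewrite -(mul1r D') -(mul1r D).
  apply: has_mean_le (has_mean_lin meanD' meanC ler01 a20) meanR _ => w.
  by rewrite !mul1r; exact: step.
split; last exact: c2le.
- by rewrite -[ttau]mulr1.
- by rewrite -[leRHS]addr0 -(mul0r G).
Qed.

End method_step.

Section inexactness.
Variables (R : realType) (normA mu th tth tau : R).
Hypotheses (normA0 : 0 <= normA) (mu0 : 0 < mu) (tau0 : 0 <= tau).
Hypotheses (tth0 : 0 <= tth) (th0 : 0 <= th).
Hypothesis tthE : tth <= mu * th / (2 * normA).

(** The tolerances are scaled so that [normA / mu], the factor from the residual
    to the constraint error, turns them into [th / 2] and [tau / 4]. *)
Lemma constraint_tolerance (C G e : R) : 0 <= C ->
  G <= tth ^+ 2 * C + mu ^+ 2 * tau / (4 * normA ^+ 2) ->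
  e <= (normA / mu) ^+ 2 * G -> e <= th ^+ 2 / 4 * C + tau / 4.
Proof.
move=> C0 GC eG; apply: (le_trans eG).
apply: le_trans (ler_wpM2l (sqr_ge0 _) GC) _.
rewrite mulrDr mulrA; apply: lerD.
  apply: ler_wpM2r => //.
  rewrite -exprMn (_ : th ^+ 2 / 4 = (th / 2) ^+ 2); last by field.
  rewrite ler_pXn2r ?nnegrE ?mulr_ge0 ?divr_ge0 ?invr_ge0 ?(ltW mu0)//.
  have [->|nA] := eqVneq normA 0; first by rewrite !mul0r divr_ge0.
  have nA0 : 0 < normA by rewrite lt_neqAle eq_sym nA.
  apply: le_trans (ler_wpM2l (divr_ge0 normA0 (ltW mu0)) tthE) _.
  rewrite le_eqVlt; apply/orP; left; apply/eqP; field.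
  by rewrite nA gt_eqF.
have [->|nA] := eqVneq normA 0; first by rewrite !mul0r expr0n/= mul0r divr_ge0.
rewrite le_eqVlt; apply/orP; left; apply/eqP; field.
by rewrite nA gt_eqF.
Qed.

End inexactness.

Theorem theorem4p9 (R : realType) (m n : nat)
    (A : 'M[R]_(m, n)) (b : 'cV[R]_m) (f : 'cV[R]_n -> R) (L mu : R)
    (d dXi : measure_display) (Omega : measurableType d)
    (P : probability Omega R) (Xi : nat -> measurableType dXi)
    (xi : forall k, Omega -> Xi k)
    (solver : forall k, 'cV[R]_n -> 'cV[R]_m -> Xi k -> 'cV[R]_n)
    (xinit : 'cV[R]_n) (lam0 : 'cV[R]_m) (alpha eta : R)
    (x : nat -> Omega -> 'cV[R]_n) (lam : nat -> Omega -> 'cV[R]_m)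
    (EkR2 : nat -> Omega -> \bar R)
    (thetae tthetae tau0 a : R) :
  let tau k := tau0 * (1 / a) ^+ k in
  let ttau k := mu ^+ 2 * tau k / (4 * mxnorm2 A ^+ 2) in
  let xstar k w := argmin (fun y => auglag f A b alpha y (lam k w)) in
  let q_alpha := moreau_negdual f A b alpha in
  let lamstar := argmin q_alpha in
  let sigma := lambda_min (A *m A^T) in
  let mu_q := sigma / (mu + L) in
  let mu_alpha := mu_q / (mu_q * alpha + 1) in
  let L_alpha := alpha^-1 in
  let rho : R := Num.max (1 - alpha * mu_alpha * (1 - thetae ^+ 2) / 2) (1 / a) in
  let A3 : R := Num.max (q_alpha lam0 - q_alpha lamstar)
                    (tau0 / (mu_alpha * (1 - thetae ^+ 2))) in
  let A1 := 4 * (1 + thetae ^+ 2) * L_alpha * A3 + 2 * tau0 in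
  let A2 := 2 * L_alpha * tthetae ^+ 2 * A3
            + mu ^+ 2 * tau0 / (4 * mxnorm2 A ^+ 2) in
  0 < sigma ->
  C1 f -> lipschitz_grad L f -> 0 < mu -> strongly_convex mu f ->
  0 < alpha -> 0 < eta ->
  0 <= thetae < 1 -> 0 <= tthetae < 1 ->
  tthetae <= mu * thetae / (2 * mxnorm2 A) ->
  0 < tau0 -> 1 < a ->
  inexact_alm A b alpha xi solver xinit lam0 x lam ->
  (forall k, cond_expectation_nneg P (history xi k)
     (fun w => enorm (residual f A b setT alpha eta (x k w) (lam k w)) ^+ 2)
     (EkR2 k)) ->
  (forall k, {ae P, forall w, (EkR2 k w <=
     (tthetae ^+ 2 * enorm (constr A b (xstar k w)) ^+ 2 + ttau k)%:E)%E}) ->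
  rho < 1 /\
  forall k : nat,
    ('E_P[fun w => (enorm (constr A b (x k w)) ^+ 2)%R]
       <= (A1 * rho ^+ k)%:E)%E /\
    ('E_P[fun w => (enorm (grad_lag f A b (x k w) (lam k.+1 w)) ^+ 2)%R]
       <= (A2 * rho ^+ k)%:E)%E.
move=> tau ttau xstar q_alpha lamstar sigma mu_q mu_alpha L_alpha rho A3 A1 A2.
move=> sigma0 f1 Lf mu0 scf alpha0 eta0 /andP[th0 th1] /andP[tth0 _] tthE tau00 a1.
move=> alm condexpR inexact.
have a0 : 0 < a by exact: lt_trans a1.
have mua0 : 0 < mu_alpha := mu_moreau_gt0 Lf mu0 alpha0 sigma0.
have amua : alpha * mu_alpha < 1 := alpha_mu_moreau_lt1 Lf mu0 alpha0 sigma0.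
have th2 : 0 <= thetae ^+ 2 < 1 by rewrite sqr_ge0 expr_lt1.
have s0 : 0 < 1 - thetae ^+ 2 by rewrite subr_gt0; case/andP: th2.
have ia0 : 0 < 1 / a by rewrite divr_gt0.
have rho_a : 1 / a <= rho by rewrite /rho le_max lexx orbT.
have rho0 : 0 < rho := lt_le_trans ia0 rho_a.
have ms0 : 0 < mu_alpha * (1 - thetae ^+ 2) by exact: mulr_gt0.
have A3tau : tau0 <= mu_alpha * (1 - thetae ^+ 2) * A3.
  by rewrite mulrC -ler_pdivrMr// /A3 le_max lexx orbT.
have A30 : 0 <= A3.
  by rewrite /A3 le_max (divr_ge0 (ltW tau00) (ltW ms0)) orbT.
have tau_pow k : (1 / a) ^+ k <= rho ^+ k by rewrite lerXn2r ?nnegrE ?(ltW ia0) ?(ltW rho0).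
have tau_ge0 k : 0 <= tau k by rewrite mulr_ge0 ?exprn_ge0 ?(ltW ia0) ?(ltW tau00).
have tau_le k : tau k <= tau0 * rho ^+ k by rewrite ler_pM2l.
have ttau_ge0 k : 0 <= ttau k.
  exact: divr_ge0 (mulr_ge0 (sqr_ge0 _) (tau_ge0 k)) (mulr_ge0 (ler0n _ 4) (sqr_ge0 _)).
split.
  rewrite /rho gt_max; apply/andP; split; last by rewrite ltr_pdivrMr// mul1r.
  by rewrite ltrBlDr ltrDl divr_gt0// -mulrA (mulr_gt0 alpha0 ms0).
pose gap u := q_alpha u - q_alpha lamstar.
have nA0 := mxnorm2_ge0 A.
have step k D := expected_step sigma0 f1 Lf mu0 scf alpha0 eta0 alm
  (condexpR k) (sqr_ge0 tthetae) (ttau_ge0 k) (inexact k) (D := D).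
have gap_le k : exists2 D, D <= A3 * rho ^+ k & has_mean P (gap \o lam k) D.
  elim: k => [|k [D DA meanD]].
    exists (gap lam0); first by rewrite expr0 mulr1 /A3 le_max lexx.
    have -> : gap \o lam 0%N = cst (gap lam0).
      by apply/funext => w /=; rewrite (alm_lam0 alm).
    exact/has_mean_cst/(gap_ge0 b sigma0 f1 Lf mu0 scf alpha0).
  have [D' [C [e [G [c2 [meanD' _ _ [C0 DC _ D'C [GC eG _]]]]]]]] := step _ _ meanD.
  exists D' => //.
  have eC := constraint_tolerance nA0 mu0 (tau_ge0 k) tth0 th0 tthE C0 GC eG.
  have B0 : 0 <= A3 * rho ^+ k by rewrite mulr_ge0// exprn_ge0// ltW.
  have tB : tau k <= mu_alpha * (1 - thetae ^+ 2) * (A3 * rho ^+ k).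
    apply: le_trans (tau_le k) _; rewrite [leRHS]mulrA.
    by rewrite ler_wpM2r// exprn_ge0// ltW.
  apply: le_trans (gap_contraction alpha0 mua0 amua th2 B0 C0 DA tB DC eC D'C) _.
  rewrite (exprS rho) [leRHS]mulrCA ler_wpM2r//.
  by rewrite /rho le_max lexx.
move=> k; have [D DA meanD] := gap_le k.
have [D' [C [e [G [c2 [_ meanc2 meanG [C0 _ CD _ [GC eG c2C]]]]]]]] := step _ _ meanD.
have eC := constraint_tolerance nA0 mu0 (tau_ge0 k) tth0 th0 tthE C0 GC eG.
have CA : C <= 2 * L_alpha * (A3 * rho ^+ k).
  have := le_trans CD DA; rewrite -ler_pdivlMl ?divr_gt0// invf_div => /le_trans; apply.
  by rewrite le_eqVlt /L_alpha eqxx.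
have La0 : 0 < L_alpha by rewrite invr_gt0.
rewrite unlock; split.
  rewrite (meanE meanc2) lee_fin /A1.
  have := tau_le k.
  have := ler_wpM2l (sqr_ge0 thetae) CA.
  have := mulr_ge0 (sqr_ge0 thetae) (le_trans C0 CA).
  have := le_trans (tau_ge0 k) (tau_le k).
  lra.
rewrite (meanE meanG) lee_fin /A2.
have h1 := ler_wpM2l (sqr_ge0 tthetae) CA.
have h2 : ttau k <= mu ^+ 2 * tau0 / (4 * mxnorm2 A ^+ 2) * rho ^+ k.
  rewrite /ttau /tau !mulrA [leRHS]mulrAC ler_wpM2r ?invr_ge0 ?mulr_ge0 ?sqr_ge0//.
  by rewrite ler_wpM2l// mulr_ge0 ?sqr_ge0// ltW.
lra.
Qed.
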